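(* Fix a signal $s_k$ and a market maker belief $\widetilde W$. For any portfolio $W\colon X\to\mathbb R$ and any marginal trade package $v\colon X\to\mathbb R$, let $\partial J(v;W)$ denote the insider's marginal gain from adding $v$ to $W$, i.e. the Gâteaux derivative at $W$ in direction $v$ of the insider's expected utility $$J(W\mid s_k;\widetilde W)=\sum_i W(x_i)\,\eta(x_i\mid s_k)-\sum_i W(x_i)\,\overline P(x_i,W;\widetilde W).$$ Then the marginal gain decomposes as $$\partial J(v;W)=\partial J_p(v;W)-\big(\partial J_{AD}(v;W)+\partial J_K(v;W)\big),$$ where $$\partial J_p(v;W)=\sum_i v(x_i)\,\eta(x_i\mid s_k)\quad\text{(marginal payoff)},$$ $$\partial J_{AD}(v;W)=\sum_i v(x_i)\,\overline P(x_i,W;\widetilde W)\quad\text{(prevailing execution price)},$$ $$\partial J_K(v;W)=\sum_i W(x_i)\;\mathbb E^{\mathbb P_W}\Big[\operatorname{Cov}\big(\eta(x_i\mid\cdot),\,\Pi_{insider}(v,\cdot\,;\widetilde W)\,\big|\,\omega\big)\Big]\quad\text{(cross-market price impact)},$$ and the covariance inside the last expectation is the price impact of $v$ on $x_i$ conditional on realized order flow $\omega$. Therefore, an optimal portfolio $W$ (a maximizer of $J(\cdot\mid s_k;\widetilde W)$) must satisfy the first-order condition $$\partial J_p(v;W)=\partial J_{AD}(v;W)+\partial J_K(v;W)\qquad\text{for all marginal trade packages } v.$$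
   Context: Setting. $X=\{x_1,x_2,\dots\}$ is a countable (finite or infinite) set of states; $S=\{s_1,\dots,s_K\}$ is a finite set of signals with prior $\pi_0$; for each $k$, $\eta(\cdot\mid s_k)$ is a probability mass function on $X$ (the payoff of Arrow–Debreu security $x_i$ under $s_k$ is $\eta(x_i\mid s_k)$). $\sigma_i>0$; noise trades $\varepsilon_i\sim\mathcal N(0,\sigma_i^2)$ are independent. Order flow is $\omega=(\omega_i)\in\mathbb R^{\infty}$; $\mathbb P_W$ is the law of $(W(x_i)+\varepsilon_i)_i$. Standing assumption: portfolios $W$ (and likewise trade packages $v$ and believed demands $\widetilde W(\cdot\mid s_l)$) satisfy $\sum_i W(x_i)^2/\sigma_i^2<\infty$. The market maker holds belief $\widetilde W(\cdot\mid\cdot)\colon X\times S\to\mathbb R$ about the insider's signal-contingent demand and has posterior over signals $$\pi_1(s_l\mid\omega;\widetilde W)\propto\exp\Big(\sum_i\tfrac{\widetilde W(x_i\mid s_l)\omega_i}{\sigma_i^2}-\tfrac12\sum_i\tfrac{\widetilde W(x_i\mid s_l)^2}{\sigma_i^2}\Big)\pi_0(s_l).$$ Prices: $P(x_i\mid\omega;\widetilde W)=\sum_l\eta(x_i\mid s_l)\,\pi_1(s_l\mid\omega;\widetilde W)$, and expected execution prices $\overline P(x_i,W;\widetilde W)=\mathbb E^{\mathbb P_W}[P(x_i\mid\omega;\widetilde W)]$. The impact exposure of a portfolio $v$ is the function of the signal $\Pi_{insider}(v,s_l;\widetilde W)=\sum_i\widetilde W(x_i\mid s_l)\,v(x_i)/\sigma_i^2$.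 For functions $f,g$ on $S$, $\operatorname{Cov}(f(\cdot),g(\cdot)\mid\omega)$ is their covariance under the posterior $\pi_1(\cdot\mid\omega;\widetilde W)$ on $S$.
   Formalization: Portfolios W and trade packages v are also required to make the two series defining J converge absolutely (square-summability alone leaves J undefined when the σ_i are unbounded), and an optimal W maximizes J over such portfolios. *)

(* Defs.v *)
From HB Require Import structures.
From mathcomp Require Import all_boot all_order all_algebra.
From mathcomp Require Import all_classical all_reals all_analysis.
From mathcomp Require Import measurable_realfun.

Set Implicit Arguments.
Unset Strict Implicit.
Unset Printing Implicit Defensive.

Import Order.TTheory GRing.Theory Num.Theory.
Import numFieldNormedType.Exports.

Local Open Scope classical_set_scope.
Local Open Scope ring_scope.

(* Sums over the finite or countably infinite type X are limits of partial sums
   along the enumeration pickle_inv (padded with zeros): the log-likelihood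
   series below is in general only conditionally convergent, so the order in
   which X is enumerated is part of its definition.  As any injection of X into
   nat can serve as its countType structure, no particular order is singled
   out. *)
Section sums.
Context {R : realType} {X : countType}.
Implicit Type f : X -> R.

Definition along f : R^nat := fun n => oapp f 0 (@pickle_inv X n).

Definition xsum f : R := limn (series (along f)).

Definition xsummable f : Prop := cvgn (series (along f)).

Definition abs_summable f : Prop := xsummable (fun x => `|f x|).

Definition has_xsum f (s : R) : Prop := series (along f) @ \oo --> s.

End sums.

Record market (R : realType) (X : countType) (S : finType) := Market {
  prior : S -> R ;
  payoff : X -> S -> R ;    (* payoff x s is eta(x | s) *)
  noise_sd : X -> R ;
  prior_ge0 : forall s, 0 <= prior s ;
  prior_sum1 : \sum_s prior s = 1 ;
  payoff_ge0 : forall x s, 0 <= payoff x s ;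
  payoff_sum1 : forall s, has_xsum (payoff ^~ s) 1 ;
  noise_sd_gt0 : forall x, 0 < noise_sd x
}.

(* R^X with the sigma-algebra generated by the coordinate maps. *)
Definition cylinders (R : realType) (X : countType) : set (set (X -> R)) :=
  [set A | exists x (B : set R),
     measurable B /\ A = (fun w : X -> R => w x) @^-1` B].

Notation order_flow R X := (g_sigma_algebraType (@cylinders R X)).

Section noise.
Context {R : realType} {X : countType} {S : finType} (M : market R X S).
Context {d : measure_display} {Omega : measurableType d}
        {P : probability Omega R}.
Variable eps : X -> {RV P >-> R}.

Definition mutually_independent : Prop :=
  forall (s : seq X) (A : X -> set R), uniq s -> (forall x, measurable (A x)) ->
    P (\bigcap_(x in [set` s]) (eps x @^-1` A x)) =
    (\prod_(x <- s) P (eps x @^-1` A x))%E.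

Definition gaussian_noise : Prop :=
  (forall x (A : set R), measurable A ->
     distribution P (eps x) A = normal_prob 0 (noise_sd M x) A) /\
  mutually_independent.

Definition realized_flow (W : X -> R) (o : Omega) : order_flow R X :=
  fun x => W x + eps x o.

Lemma measurable_realized_flow W :
  measurable_fun [set: Omega] (realized_flow W).
Proof.
apply: (@measurability _ _ Omega (order_flow R X) setT _ (@cylinders R X)) => //.
move=> _ [_ [x [B [mB ->]]] <-].
have mf : measurable_fun [set: Omega] (fun o => W x + eps x o).
  exact: measurable_funD.
exact: (mf measurableT B mB).
Qed.

HB.instance Definition _ W := @isMeasurableFun.Build _ _ Omega (order_flow R X)
  (realized_flow W) (measurable_realized_flow W).

(* The law P_W of (W(x) + eps_x)_x on R^X. *)
Definition flow_law (W : X -> R) : probability (order_flow R X) R :=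
  distribution P (realized_flow W).

Definition flow_mean (W : X -> R) (f : order_flow R X -> R) : R :=
  fine 'E_(flow_law W)[f]%E.

End noise.

Section pricing.
Context {R : realType} {X : countType} {S : finType} (M : market R X S).
Implicit Types (Wt : X -> S -> R) (W v w : X -> R) (f g : S -> R).

Definition portfolio W : Prop :=
  xsummable (fun x => W x ^+ 2 / noise_sd M x ^+ 2).

Definition likelihood Wt (l : S) w : R :=
  expR (xsum (fun x => Wt x l * w x / noise_sd M x ^+ 2)
        - 2^-1 * xsum (fun x => Wt x l ^+ 2 / noise_sd M x ^+ 2)).

Definition posterior Wt (l : S) w : R :=
  likelihood Wt l w * prior M l / \sum_m likelihood Wt m w * prior M m.

Definition price Wt (x : X) w : R :=
  \sum_l payoff M x l * posterior Wt l w.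

Definition insider_exposure Wt v (l : S) : R :=
  xsum (fun x => Wt x l * v x / noise_sd M x ^+ 2).

Definition posterior_mean Wt f w : R := \sum_l f l * posterior Wt l w.

Definition posterior_cov Wt f g w : R :=
  posterior_mean Wt (fun l => (f l - posterior_mean Wt f w) *
                              (g l - posterior_mean Wt g w)) w.

End pricing.

Definition is_gateaux {R : realType} {X : countType}
    (F : (X -> R) -> R) (W v : X -> R) (D : R) : Prop :=
  is_derive (0 : R) (1 : R) (fun t : R => F (fun x => W x + t * v x)) D.

Section insider.
Context {R : realType} {X : countType} {S : finType} (M : market R X S).
Context {d : measure_display} {Omega : measurableType d}
        {P : probability Omega R} (eps : X -> {RV P >-> R}).
Variables (Wt : X -> S -> R) (k : S).
Implicit Types W v : X -> R.

Definition exec_price W (x : X) : R :=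
  flow_mean eps W (fun w => price M Wt x w).

Definition J W : R :=
  xsum (fun x => W x * payoff M x k) - xsum (fun x => W x * exec_price W x).

(* Square-summability of W / sigma does not make the two series in J converge
   when sigma is unbounded; this is the set of portfolios on which J is
   defined. *)
Definition dom_J W : Prop :=
  [/\ portfolio M W,
      abs_summable (fun x => W x * payoff M x k) &
      abs_summable (fun x => W x * exec_price W x)].

Definition dJ_p v : R := xsum (fun x => v x * payoff M x k).

Definition dJ_AD v W : R := xsum (fun x => v x * exec_price W x).

Definition price_impact v (x : X) (w : X -> R) : R :=
  posterior_cov M Wt (payoff M x) (insider_exposure M Wt v) w.

Definition mean_price_impact v W (x : X) : R :=
  flow_mean eps W (fun w => price_impact v x w).

Definition dJ_K v W : R := xsum (fun x => W x * mean_price_impact v W x).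

Definition optimal W : Prop :=
  dom_J W /\ forall W', dom_J W' -> J W' <= J W.

End insider.

(* Main.v *)
(* The order flow enters the posterior only through the log-likelihoods
   sum_x Wt(x|l) w(x) / sd(x)^2, which are linear in w where they converge.
   Along w + t v the posterior is therefore a softmax in t with slopes the
   impact exposures of v, and its derivative is the posterior times the centred
   exposure; summing against the payoffs gives the covariance in dJ_K.

   The log-likelihoods converge almost surely.  This is Kolmogorov's theorem: the
   sums of symmetric independent terms, frozen when they first reach lam, have
   second moment at most the sum of the variances.  Flipping the sign of the next
   term does not change the joint law, so the cross term drops out of the second
   moment and only nonnegative integrals are needed.

   The softmax slopes are bounded by the exposures, which allows differentiating
   under the expectation.  A signal of positive prior has a positive mean
   posterior, so the execution price of x dominates each of its payoffs under
   these finitely many signals.  Hence membership in dom_J makes the payoffs of W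
   summable under each of them separately, and the sum of W times the execution
   price is a finite sum of values of W, linear in W, times mean posteriors. *)
From HB Require Import structures.
Require Import Defs.
From mathcomp Require Import all_boot all_order all_algebra.
From mathcomp Require Import all_classical all_reals all_analysis.
From mathcomp Require Import measurable_realfun.
From mathcomp Require Import ring lra.

Import Order.TTheory GRing.Theory Num.Theory.
Import numFieldNormedType.Exports.

Set Implicit Arguments.
Unset Strict Implicit.
Unset Printing Implicit Defensive.

Local Open Scope classical_set_scope.
Local Open Scope ring_scope.

(** * Normal laws *)

Section gaussian.
Context {R : realType}.
Local Notation mu := (@lebesgue_measure R).

Lemma ge0_integral_opp (f : R -> \bar R) : measurable_fun setT f ->
  (forall x, 0 <= f x)%E -> (\int[mu]_x f x = \int[mu]_x f (- x)%R)%E.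
Proof.
move=> mf f0.
rewrite -[RHS](@ge0_integral_pushforward _ _ _ (measurableTypeR R) R
  (-%R : measurableTypeR R -> measurableTypeR R) _ mu setT f)//.
by apply: eq_measure_integral => A mA _; exact/esym/lebesgue_measureN.
Qed.

Lemma normal_pdf_opp (s x : R) : s != 0 ->
  normal_pdf 0 s (- x) = normal_pdf 0 s x.
Proof. by move=> s0; rewrite !normal_pdfE// /normal_fun !subr0 sqrrN. Qed.

Lemma normal_prob_opp (s : R) (A : set R) : s != 0 -> measurable A ->
  normal_prob 0 s (-%R @^-1` A) = normal_prob 0 s A.
Proof.
move=> s0 mA.
have mN : measurable_fun [set: R] (-%R : R -> R) by [].
have mNA : measurable (-%R @^-1` A).
  by rewrite -[X in measurable X]setTI; exact: mN.
rewrite /normal_prob integral_mkcond [RHS]integral_mkcond [RHS]ge0_integral_opp.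
- apply: eq_integral => x _; rewrite !patchE/=.
  rewrite (_ : (- x \in A) = (x \in -%R @^-1` A)); last first.
    by apply/idP/idP => /set_mem xA; exact/mem_set.
  by case: ifP => // _; rewrite normal_pdf_opp//.
- apply/(measurable_restrictT _ _).1 => //; apply/measurable_EFinP.
  apply: (measurable_funS measurableT (@subsetT _ _)).
  exact: measurable_normal_pdf.
- by apply: erestrict_ge0 => x _; rewrite lee_fin normal_pdf_ge0.
Qed.

(** The Radon-Nikodym derivative of the normal law and [normal_pdf] have the same integral over
    every measurable set, hence agree almost everywhere, so change of variables for the former gives
    the formula for the latter. *)
Lemma ge0_integral_normal_prob (m s : R) (f : R -> \bar R) :
  measurable_fun setT f -> (forall x, 0 <= f x)%E ->
  (\int[normal_prob m s]_x f x = \int[mu]_x (f x * (normal_pdf m s x)%:E))%E.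
Proof.
move=> mf f0; have dom := normal_prob_dominates m s.
rewrite -(Radon_Nikodym_SigmaFinite.change_of_variables dom f0)//.
have mp := measurable_normal_pdf m s.
have aee : ae_eq mu setT
    (Radon_Nikodym_SigmaFinite.f (normal_prob m s) mu)
    (fun x => (normal_pdf m s x)%:E).
  apply: integral_ae_eq => //; first exact: Radon_Nikodym_SigmaFinite.f_integrable.
    exact/measurable_EFinP.
  by move=> E _ mE; rewrite -Radon_Nikodym_SigmaFinite.f_integral.
apply: ae_eq_integral => //.
- apply: emeasurable_funM => //.
  apply: (measurable_int mu); exact: Radon_Nikodym_SigmaFinite.f_integrable.
- by apply: emeasurable_funM => //; exact/measurable_EFinP.
- by apply: filterS aee => x h _; rewrite h.
Qed.

(* [u <= expR u] at u = (x / 2s)^2 trades the factor x^2 for a doubling of the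
   variance, so the bound only needs the total mass of a normal density. *)
Lemma normal_pdf_second_moment (s x : R) : 0 < s ->
  x ^+ 2 * normal_pdf 0 s x
    <= 4 * Num.sqrt 2 * s ^+ 2 * normal_pdf 0 (Num.sqrt 2 * s) x.
Proof.
move=> s0; have s20 : 0 < Num.sqrt 2 * s by rewrite mulr_gt0// sqrtr_gt0.
rewrite !normal_pdfE ?gt_eqF// /normal_peak /normal_fun subr0.
have -> : (Num.sqrt 2 * s) ^+ 2 = 2 * s ^+ 2 by rewrite exprMn sqr_sqrtr.
have -> : 2 * s ^+ 2 * pi *+ 2 = 2 * (s ^+ 2 * pi *+ 2) by ring.
rewrite [Num.sqrt (2 * _)]sqrtrM// invfM.
set p := (Num.sqrt (s ^+ 2 * _ *+ 2))^-1.
have p0 : 0 <= p by rewrite invr_ge0.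
pose u := (x / (2 * s)) ^+ 2.
have xu : x ^+ 2 = 4 * s ^+ 2 * u by rewrite /u; field; rewrite gt_eqF.
have -> : - x ^+ 2 / (s ^+ 2 *+ 2) = - u - u.
  by rewrite xu; field; rewrite gt_eqF.
have -> : - x ^+ 2 / (2 * s ^+ 2 *+ 2) = - u.
  by rewrite xu; field; rewrite gt_eqF.
rewrite expRD xu.
have ue : u * expR (- u) <= 1.
  rewrite expRN ler_pdivrMr ?expR_gt0// mul1r.
  by apply: le_trans (expR_ge1Dx u); lra.
have r2 : Num.sqrt 2 != 0 :> R by rewrite gt_eqF// sqrtr_gt0.
have -> : 4 * Num.sqrt 2 * s ^+ 2 * ((Num.sqrt 2)^-1 * p * expR (- u)) =
  4 * s ^+ 2 * p * expR (- u) * 1 by field.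
have -> : 4 * s ^+ 2 * u * (p * (expR (- u) * expR (- u))) =
  4 * s ^+ 2 * p * expR (- u) * (u * expR (- u)) by ring.
by apply: ler_wpM2l => //; rewrite !mulr_ge0 ?expR_ge0// ltW.
Qed.

(** The constant is not sharp, the variance being [s ^+ 2]; any fixed multiple of it serves, as
    these bounds only have to be summable. *)
Lemma normal_prob_second_moment (s : R) : 0 < s ->
  (\int[normal_prob 0 s]_x (x ^+ 2)%:E <= (4 * Num.sqrt 2 * s ^+ 2)%:E)%E.
Proof.
move=> s0; have mX : measurable_fun [set: R] (fun x : R => x ^+ 2).
  exact: measurable_funX.
have mp t := @measurable_normal_pdf R 0 t.
rewrite ge0_integral_normal_prob; last 2 first.
- exact/measurable_EFinP.
- by move=> x; rewrite lee_fin sqr_ge0.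
rewrite -[leRHS]mule1 -(integral_normal_pdf 0 (Num.sqrt 2 * s)).
rewrite -ge0_integralZl//; last 3 first.
- by apply/measurable_EFinP; exact: mp.
- by move=> x _; rewrite lee_fin normal_pdf_ge0.
- by rewrite lee_fin !mulr_ge0// ltW.
apply: ge0_le_integral => //.
- by move=> x _; rewrite mule_ge0// lee_fin ?sqr_ge0// normal_pdf_ge0.
- by apply: emeasurable_funM; apply/measurable_EFinP => //; exact: mp.
- by apply: emeasurable_funM; apply/measurable_EFinP => //; exact: mp.
- by move=> x _; rewrite -!EFinM lee_fin normal_pdf_second_moment.
Qed.

End gaussian.

(** * Almost sure convergence of symmetric series *)

Section symmetric_increment.
Context {R : realType} {d : measure_display} {Omega : measurableType d}
        (P : probability Omega R).

(** The restrictions of [P] to [E] and to [E'] are finite measures that agree on a pi-system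
    containing the whole space, so they agree on the generated sigma-algebra. *)
Lemma pi_system_extend (G : set (set Omega)) (E E' : set Omega) :
  setI_closed G -> G setT -> G `<=` measurable ->
  measurable E -> measurable E' ->
  (forall A, G A -> P (A `&` E) = P (A `&` E')) ->
  forall A, <<s G >> A -> P (A `&` E) = P (A `&` E').
Proof.
move=> GI GT Gm mE mE' GE A sA.
apply: (g_sigma_algebra_measure_unique G Gm (fun=> setT) _ _
  (mrestr P mE) (mrestr P mE')) => //.
- by apply/seteqP; split => // x _; exists 0.
- by move=> _ /=; rewrite /mrestr setTI -ge0_fin_numE// fin_num_measure.
Qed.

(** The laws of [(Z, Y)] and [(Z, - Y)] agree on measurable rectangles, a pi-system generating the
    product sigma-algebra, so they are equal. *)
Lemma ge0_integral_symmetric_pair (Z Y : Omega -> R) (f : R * R -> \bar R) :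
  measurable_fun setT Z -> measurable_fun setT Y ->
  measurable_fun setT f -> (forall p, 0 <= f p)%E ->
  (forall A B : set R, measurable A -> measurable B ->
     P (Z @^-1` A `&` Y @^-1` B) = P (Z @^-1` A `&` (fun o => - Y o) @^-1` B)) ->
  (\int[P]_o f (Z o, Y o) = \int[P]_o f (Z o, - Y o)%R)%E.
Proof.
move=> mZ mY mf f0 ZY.
have mp1 : measurable_fun setT (fun o => (Z o, Y o)) by exact: measurable_fun_pair.
have mp2 : measurable_fun setT (fun o => (Z o, - Y o)).
  by apply: measurable_fun_pair => //; exact: measurableT_comp.
pose p1 : {mfun Omega >-> (R * R)%type} := HB.pack (fun o => (Z o, Y o))
  (isMeasurableFun.Build _ _ _ _ _ mp1).
pose p2 : {mfun Omega >-> (R * R)%type} := HB.pack (fun o => (Z o, - Y o))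
  (isMeasurableFun.Build _ _ _ _ _ mp2).
have e : forall A, measurable A -> distribution P p1 A = distribution P p2 A.
  apply: (measure_unique [set A `*` B | A in measurable & B in measurable]
    (fun=> setT)) => //.
  - by rewrite -measurable_prod_measurableType.
  - move=> _ _ [A1 mA1 [B1 mB1 <-]] [A2 mA2 [B2 mB2 <-]]; rewrite -setXI.
    exists (A1 `&` A2); first exact: measurableI.
    by exists (B1 `&` B2) => //; exact: measurableI.
  - by move=> _; exists setT => //; exists setT => //; rewrite setXTT.
  - by apply/seteqP; split => // x _; exists 0.
  - by move=> _ [A mA [B mB <-]]; exact: ZY.
  - by move=> _ /=; rewrite -ge0_fin_numE// fin_num_measure.
have e1 := @ge0_integral_distribution _ _ _ _ _ P p1 f mf f0.
have e2 := @ge0_integral_distribution _ _ _ _ _ P p2 f mf f0.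
rewrite (_ : (fun o => f (Z o, Y o)) = f \o p1)// -e1.
rewrite (_ : (fun o => f (Z o, - Y o)) = f \o p2)// -e2.
by apply: eq_measure_integral => A mA _; exact: e.
Qed.

End symmetric_increment.

(** * Partial sums stopped at a level *)

Section stopped_sum.
Context {R : realType}.

(* The partial sums of Y, frozen at the first time they reach lam in absolute
   value. *)
Fixpoint stopped {T : Type} (lam : R) (Y : nat -> T -> R) (n : nat) (o : T) :
    R :=
  if n is n'.+1 then
    let t := stopped lam Y n' o in if `|t| < lam then t + Y n' o else t
  else 0.

(** Invariant of the recursion: not frozen before step [n], or already at the level. The bound
    covers [k < n] only, since the sum at [n] may be the first to reach [lam]; both alternatives
    then hold. *)
Lemma stoppedP (T : Type) (lam : R) (Y : nat -> T -> R) n o :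
  stopped lam Y n o = \sum_(i < n) Y i o /\
    (forall k, (k < n)%N -> `|\sum_(i < k) Y i o| < lam)
  \/ lam <= `|stopped lam Y n o|.
Proof.
elim: n => [|n IH] /=; first by left; rewrite big_ord0.
case: ltP => [tl|]; last by right.
case: IH => [[tE small]|]; last by rewrite leNgt tl.
left; rewrite big_ord_recr/= tE; split => // k.
by rewrite ltnS leq_eqVlt => /predU1P[->|/small//]; rewrite -tE.
Qed.

Lemma stopped_ge (T : Type) (lam : R) (Y : nat -> T -> R) n o k : (k <= n)%N ->
  lam <= `|\sum_(i < k) Y i o| -> lam <= `|stopped lam Y n o|.
Proof.
move=> kn lk; have [[-> small]|//] := stoppedP lam Y n o.
by move: kn; rewrite leq_eqVlt => /predU1P[<-//|/small]; rewrite ltNge lk.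
Qed.

Lemma measurable_stopped d (T : measurableType d) (lam : R)
    (Y : nat -> T -> R) n :
  (forall i, (i < n)%N -> measurable_fun setT (Y i)) ->
  measurable_fun setT (stopped lam Y n).
Proof.
elim: n => [|n IH] mY //=; have mS := IH (fun i ni => mY i (ltnW ni)).
apply: measurable_fun_ifT => //.
- by apply: measurable_fun_ltr => //; exact: measurableT_comp.
- by apply: measurable_funD => //; exact: mY.
Qed.

End stopped_sum.

Lemma measurable_norm_ge {R : realType} d (T : measurableType d) (h : T -> R)
    (lam : R) : measurable_fun setT h -> measurable [set o | lam <= `|h o|].
Proof.
move=> mh; have mn : measurable_fun setT (fun o => `|h o|).
  exact: measurableT_comp.
rewrite (_ : [set o | _] = setT `&` (fun o => `|h o|) @^-1` `[lam, +oo[%classic).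
  by apply: mn => //; exact: measurable_itv.
by apply/seteqP; split => o /=; rewrite in_itv/= andbT => // -[].
Qed.

(** * Kolmogorov's maximal inequality for symmetric increments *)

Section kolmogorov.
Context {R : realType} {d : measure_display} {Omega : measurableType d}
        (P : probability Omega R).
Variables (Y : nat -> Omega -> R) (G : nat -> set (set Omega)) (v : nat -> R).
Hypotheses (mY : forall n, measurable_fun setT (Y n))
  (GI : forall n, setI_closed (G n)) (GT : forall n, G n setT)
  (Gm : forall n, G n `<=` measurable)
  (YG : forall n i B, (i < n)%N -> measurable B -> <<s G n >> (Y i @^-1` B))
  (Ysym : forall n A B, G n A -> measurable B ->
     P (A `&` Y n @^-1` B) = P (A `&` (fun o => - Y n o) @^-1` B))
  (Yv : forall n, (\int[P]_o (Y n o ^+ 2)%:E <= (v n)%:E)%E).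

(** By symmetry [(s + y)^2] and [(s - y)^2] have equal integrals, and they add up to
    [2 s^2 + 2 y^2]. Bounding twice the left side therefore never involves the integral of [s y],
    which has no sign. *)
Lemma stopped_second_moment_step (lam : R) n :
  (\int[P]_o (stopped lam Y n.+1 o ^+ 2)%:E <=
   \int[P]_o (stopped lam Y n o ^+ 2)%:E + (v n)%:E)%E.
Proof.
have mS k : measurable_fun setT (stopped lam Y k) by exact: measurable_stopped.
(* Events about the stopped sum thus lie in the sigma-algebra generated by [G n], to which
   [pi_system_extend] carries the sign flip of [Y n]. *)
have mSG : measurable_fun [set: g_sigma_algebraType (G n)]
    (stopped lam Y n : g_sigma_algebraType (G n) -> R).
  apply: measurable_stopped => i ni _ B mB; rewrite setTI; exact: YG.
pose f (p : R * R) : \bar R :=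
  ((p.1 + (if `|p.1| < lam then p.2 else 0)) ^+ 2)%:E.
have mf : measurable_fun setT f.
  apply/measurable_EFinP; apply: measurable_funX; apply: measurable_funD => //.
  apply: measurable_fun_ifT => //.
  by apply: measurable_fun_ltr => //; exact: measurableT_comp.
have f0 p : (0 <= f p)%E by rewrite lee_fin sqr_ge0.
have mYn : measurable_fun setT (fun o => - Y n o) by exact: measurableT_comp.
have pre (Z : Omega -> R) B : measurable_fun setT Z -> measurable B ->
    measurable (Z @^-1` B).
  by move=> mZ mB; rewrite -[X in measurable X]setTI; exact: mZ.
have sym := @ge0_integral_symmetric_pair _ _ _ P _ _ _ (mS n) (mY n) mf f0.
have {}sym : (\int[P]_o f (stopped lam Y n o, Y n o) =
              \int[P]_o f (stopped lam Y n o, - Y n o)%R)%E.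
  apply: sym => A B mA mB.
  apply: (@pi_system_extend _ _ _ P (G n)) => //.
  - exact: pre.
  - exact: pre.
  - by move=> C GC; exact: Ysym.
  - by have := mSG measurableT A mA; rewrite setTI.
have mp1 : measurable_fun setT (fun o => f (stopped lam Y n o, Y n o)).
  by apply: (measurableT_comp mf); exact: measurable_fun_pair.
have mp2 : measurable_fun setT (fun o => f (stopped lam Y n o, - Y n o)%R).
  by apply: (measurableT_comp mf); exact: measurable_fun_pair.
have mS2 : measurable_fun setT (fun o => (stopped lam Y n o ^+ 2)%:E).
  by apply/measurable_EFinP; exact: measurable_funX.
have mY2 : measurable_fun setT (fun o => (Y n o ^+ 2)%:E).
  by apply/measurable_EFinP; exact: measurable_funX.
have E1 : (\int[P]_o (stopped lam Y n.+1 o ^+ 2)%:E =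
           \int[P]_o f (stopped lam Y n o, Y n o))%E.
  apply: eq_integral => o _; rewrite /f /=.
  by case: ifP => // _; rewrite addr0.
have : (\int[P]_o (stopped lam Y n.+1 o ^+ 2)%:E +
        \int[P]_o (stopped lam Y n.+1 o ^+ 2)%:E <=
        (\int[P]_o (stopped lam Y n o ^+ 2)%:E + (v n)%:E) +
        (\int[P]_o (stopped lam Y n o ^+ 2)%:E + (v n)%:E))%E.
  rewrite [X in (X + _)%E]E1 E1 {2}sym -ge0_integralD//.
  apply: (@le_trans _ _ (\int[P]_o
      (((stopped lam Y n o ^+ 2)%:E + (Y n o ^+ 2)%:E) +
       ((stopped lam Y n o ^+ 2)%:E + (Y n o ^+ 2)%:E)))%E).
    apply: ge0_le_integral => //.
    - by move=> o _; rewrite adde_ge0.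
    - exact: emeasurable_funD.
    - by do 2! apply: emeasurable_funD => //.
    - move=> o _; rewrite /f/= -!EFinD lee_fin; case: ifP => _.
        by rewrite le_eqVlt; apply/orP; left; apply/eqP; ring.
      by rewrite !addr0 lerD// lerDl sqr_ge0.
  have q0 (x : R) : (0 <= (x ^+ 2)%:E)%E by rewrite lee_fin sqr_ge0.
  rewrite ge0_integralD//; last 4 first.
  - by move=> o _; rewrite adde_ge0.
  - exact: emeasurable_funD.
  - by move=> o _; rewrite adde_ge0.
  - exact: emeasurable_funD.
  by rewrite ge0_integralD// leeD// leeD.
set a := (\int[P]_o (stopped lam Y n.+1 o ^+ 2)%:E)%E.
set b := (\int[P]_o (stopped lam Y n o ^+ 2)%:E + (v n)%:E)%E => ab.
have a0 : (0 <= a)%E by apply: integral_ge0 => o _; rewrite lee_fin sqr_ge0.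
(* Halving the doubled inequality: [b < a] would make [b] finite and give [b + b < a + a]. *)
rewrite leNgt; apply/negP => ba.
move: ab; rewrite leNgt => /negP; apply.
have b0 : (0 <= b)%E.
  rewrite adde_ge0//.
    by apply: integral_ge0 => o _; rewrite lee_fin sqr_ge0.
  by apply: le_trans (Yv n); apply: integral_ge0 => o _; rewrite lee_fin sqr_ge0.
have bfin : b \is a fin_num.
  by rewrite ge0_fin_numE//; exact: lt_le_trans ba (leey _).
by rewrite lteD.
Qed.

Lemma stopped_second_moment (lam : R) n :
  (\int[P]_o (stopped lam Y n o ^+ 2)%:E <= (\sum_(i < n) v i)%:E)%E.
Proof.
elim: n => [|n IH].
  rewrite big_ord0/= (eq_integral (cst 0%E)) ?integral0// => o _.
  by rewrite expr0n.
rewrite (le_trans (stopped_second_moment_step lam n))//.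
by rewrite big_ord_recr/= EFinD leeD.
Qed.

(** If some partial sum up to [n] reaches [lam], the stopped sum at [n] has absolute value at least
    [lam]; Chebyshev's inequality for the stopped sum then suffices. *)
Lemma kolmogorov_maximal (lam : R) n : 0 < lam ->
  ((lam ^+ 2)%:E * P [set o | exists2 k, (k <= n)%N &
      (lam <= `|\sum_(i < k) Y i o|)%R] <= (\sum_(i < n) v i)%:E)%E.
Proof.
move=> lam0.
have mS k : measurable_fun setT (fun o => \sum_(i < k) Y i o).
  by apply: measurable_sum.
have mSt : measurable_fun setT (stopped lam Y n) by exact: measurable_stopped.
apply: le_trans (stopped_second_moment lam n).
apply: (@le_trans _ _
  ((lam ^+ 2)%:E * P [set o | (lam <= `|stopped lam Y n o|)%R])%E).
  apply: lee_pmul => //.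
    by rewrite lee_fin sqr_ge0.
  apply: le_measure; rewrite ?inE; last 2 first.
  - exact: measurable_norm_ge.
  - by move=> o [k kn /(stopped_ge kn)].
  rewrite (_ : [set o | _] = \bigcup_(k in [set k | (k <= n)%N])
      [set o | lam <= `|\sum_(i < k) Y i o|]).
    by apply: bigcup_measurable => k _; exact: measurable_norm_ge.
  by apply/seteqP; split => o [k kn lk]; exists k.
rewrite -integral_cst//; last exact: measurable_norm_ge.
rewrite integral_mkcond; apply: ge0_le_integral => //.
- by move=> o _; apply: erestrict_ge0 => ? _; rewrite lee_fin sqr_ge0.
- apply/(measurable_restrictT _ _).1 => //; exact: measurable_norm_ge.
- by apply/measurable_EFinP; exact: measurable_funX.
- move=> o _; rewrite patchE; case: ifPn => [|_]; last by rewrite lee_fin sqr_ge0.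
  rewrite inE/= => lo; rewrite lee_fin.
  rewrite -(@real_normK _ (stopped lam Y n o)) ?num_real//.
  by rewrite lerXn2r// nnegrE ltW.
Qed.

End kolmogorov.

Lemma series_addnB {R : realType} (u : R^nat) m n :
  series u (m + n)%N - series u m = \sum_(i < n) u (m + i)%N.
Proof.
by rewrite /series/= !big_mkord big_split_ord/= [X in X - _]addrC addrK.
Qed.

(** * From tail estimates to almost sure convergence *)

Section almost_sure_convergence.
Context {R : realType} {d : measure_display} {Omega : measurableType d}
        (P : probability Omega R).
Variables (Y : nat -> Omega -> R) (G : nat -> set (set Omega)) (v : nat -> R).
Hypotheses (mY : forall n, measurable_fun setT (Y n))
  (GI : forall n, setI_closed (G n)) (GT : forall n, G n setT)
  (Gm : forall n, G n `<=` measurable)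
  (YG : forall n i B, (i < n)%N -> measurable B -> <<s G n >> (Y i @^-1` B))
  (Ysym : forall n A B, G n A -> measurable B ->
     P (A `&` Y n @^-1` B) = P (A `&` (fun o => - Y n o) @^-1` B))
  (Yv : forall n, (\int[P]_o (Y n o ^+ 2)%:E <= (v n)%:E)%E)
  (cv : cvgn (series v)).

Let late m (lam : R) n :=
  [set o | exists2 k, (k <= n)%N & lam <= `|\sum_(i < k) Y (m + i)%N o|].

Let measurable_late m lam n : measurable (late m lam n).
Proof.
rewrite (_ : late m lam n = \bigcup_(k in [set k | (k <= n)%N])
    [set o | lam <= `|\sum_(i < k) Y (m + i)%N o|]); last first.
  by apply/seteqP; split => o [k kn lk]; exists k.
apply: bigcup_measurable => k _; apply: measurable_norm_ge.
exact: measurable_sum.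
Qed.

Let v_ge0 n : 0 <= v n.
Proof.
rewrite -lee_fin; apply: le_trans (Yv n).
by apply: integral_ge0 => o _; rewrite lee_fin sqr_ge0.
Qed.

Let tail m := limn (series v) - series v m.

Let sum_le_tail m n : \sum_(i < n) v (m + i)%N <= tail m.
Proof.
rewrite -series_addnB /tail lerD2r; apply: nondecreasing_cvgn_le => //.
by apply/nondecreasing_series => i _ _; exact: v_ge0.
Qed.

(** The maximal inequality for the terms from [m] on has a bound uniform in [n], which passes to the
    increasing union by continuity from below. *)
Let late_le m lam : 0 < lam ->
  ((lam ^+ 2)%:E * P (\bigcup_n late m lam n) <= (tail m)%:E)%E.
Proof.
move=> lam0.
have nd : {homo late m lam : p q / (p <= q)%N >-> (p <= q)%O}.
  move=> p q pq; apply/subsetPset => o [k kp lk]; exists k => //.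
  exact: leq_trans pq.
have c := nondecreasing_cvg_mu (mu := P) (@measurable_late m lam)
  (bigcupT_measurable _ (@measurable_late m lam)) nd.
have {c} c : ((lam ^+ 2)%:E * P (late m lam n) @[n --> \oo] -->
    (lam ^+ 2)%:E * P (\bigcup_n late m lam n))%E by exact: cvgeZl.
apply: (cvge_le _ c); apply: nearW => n.
apply: le_trans (_ : (\sum_(i < n) v (m + i)%N)%:E <= _)%E; last first.
  by rewrite lee_fin sum_le_tail.
apply: (@kolmogorov_maximal _ _ _ P (fun i => Y (m + i)%N)
  (fun i => G (m + i)%N) (fun i => v (m + i)%N)) => //.
- by move=> p i B ip; apply: YG; rewrite ltn_add2l.
- by move=> p A B; exact: Ysym.
Qed.

Let tail0 : tail m @[m --> \oo] --> 0.
Proof.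
rewrite -(subrr (limn (series v))); apply: cvgB; [exact: cvg_cst|exact: cv].
Qed.

(** For every [m], the probability of [bad j] is at most [tail m] divided by the square of a fixed
    level, and the tails tend to 0. Outside the countably many null sets [bad j] the partial sums
    are Cauchy. *)
Lemma ae_cvg_series_symmetric : {ae P, forall o, cvgn (series (fun n => Y n o))}.
Proof.
pose bad j := \bigcap_m \bigcup_n late m (j.+1%:R^-1) n.
have mbad j : measurable (bad j).
  apply: bigcapT_measurable => m; apply: bigcupT_measurable => n.
  exact: measurable_late.
have bad0 j : P.-negligible (bad j).
  apply/negligibleP => //; pose lam : R := j.+1%:R^-1.
  have lam0 : 0 < lam by rewrite invr_gt0.
  have le m : ((lam ^+ 2)%:E * P (bad j) <= (tail m)%:E)%E.
    apply: le_trans (late_le m lam0); apply: lee_pmul => //.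
      by rewrite lee_fin sqr_ge0.
    apply: le_measure; rewrite ?inE//; last by move=> o; apply.
    by apply: bigcupT_measurable => n; exact: measurable_late.
  have P0 : ((lam ^+ 2)%:E * P (bad j) <= 0)%E.
    have ct : (tail m)%:E @[m --> \oo] --> (0 : R)%:E.
      by apply: cvg_EFin; [exact: nearW|exact: tail0].
    by apply: (cvge_ge _ ct); apply: nearW.
  apply/eqP; rewrite eq_le measure_ge0 andbT.
  by rewrite -(@lee_pmul2l _ (lam ^+ 2)%:E) ?mule0// lte_fin exprn_gt0.
have := negligible_bigcup bad0; apply: negligibleS => o /= dv.
apply: contrapT => nbad; apply: dv.
apply/cauchy_cvgP/cauchy_exP => e e0.
have [j je] : exists j : nat, j.+1%:R^-1 < e.
  exists (Num.truncn e^-1); rewrite invf_plt ?posrE//; exact: truncnS_gt.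
have [m nm] : exists m, ~ (\bigcup_n late m (j.+1%:R^-1) n) o.
  apply: contrapT => h; apply: nbad; exists j => // m _.
  by apply: contrapT => h'; apply: h; exists m.
exists (series (fun n => Y n o) m); exists m => // n /= mn.
rewrite /ball/= distrC; apply: lt_trans je; rewrite ltNge; apply/negP => le.
apply: nm; exists (n - m)%N => //; exists (n - m)%N => //.
by rewrite -(series_addnB (fun n => Y n o)) subnKC.
Qed.

End almost_sure_convergence.

(** * The noise *)

Section gaussian_series.
Context {R : realType} {X : countType} {S : finType} (M : market R X S)
  {d : measure_display} {Omega : measurableType d} {P : probability Omega R}
  (eps : X -> {RV P >-> R}).
Hypothesis noise : gaussian_noise M eps.

Lemma measurable_preimage_eps x (B : set R) : measurable B ->
  measurable (eps x @^-1` B).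
Proof.
by move=> mB; rewrite -[X in measurable X]setTI; exact: measurable_funP.
Qed.

(** Cylinder events in finitely many noises other than the one at index [n]: the pi-system [G n] of
    the convergence theorem, in the form to which [mutually_independent] applies directly. *)
Definition events_avoiding (n : nat) : set (set Omega) :=
  [set E | exists (s : seq X) (A : X -> set R), [/\ uniq s,
     (forall x, measurable (A x)), (forall x, x \in s -> pickle_inv n != Some x) &
     E = \bigcap_(x in [set` s]) (eps x @^-1` A x)]].

Lemma events_avoiding_setI n : setI_closed (events_avoiding n).
Proof.
move=> _ _ [s [A [us mA ns ->]]] [t [B [ut mB nt ->]]].
(* A coordinate listed on one side only is unconstrained on the other, hence the default [setT]. *)
pose C x := (if x \in s then A x else setT) `&` (if x \in t then B x else setT).
exists (undup (s ++ t)), C; split.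
- exact: undup_uniq.
- by move=> x; apply: measurableI; case: ifP.
- by move=> x; rewrite mem_undup mem_cat => /orP[/ns|/nt].
- apply/seteqP; split => o.
    move=> [sA tB] x /= _; split.
      by case: ifP => // xs; exact: sA.
    by case: ifP => // xt; exact: tB.
  move=> h; split => x /= xs.
    have [] := h x; first by rewrite /= mem_undup mem_cat xs.
    by rewrite xs.
  have [] := h x; first by rewrite /= mem_undup mem_cat xs orbT.
  by rewrite xs.
Qed.

Lemma events_avoidingT n : events_avoiding n setT.
Proof.
exists [::], (fun=> setT); split => //.
by apply/seteqP; split => // o _ x.
Qed.

Lemma measurable_events_avoiding n : events_avoiding n `<=` measurable.
Proof.
move=> _ [s [A [us mA ns ->]]].
rewrite bigcap_seq; apply: bigsetI_measurable => x _.
exact: measurable_preimage_eps.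
Qed.

Definition noise_term (a : X -> R) (n : nat) (o : Omega) : R :=
  along (fun x => a x * eps x o) n.

Lemma measurable_noise_term a n : measurable_fun setT (noise_term a n).
Proof.
rewrite /noise_term /along; case: pickle_inv => [x|] /=; last exact: measurable_cst.
by apply: measurable_funM => //; exact: measurable_cst.
Qed.

Lemma noise_term_events_avoiding a n i (B : set R) : (i < n)%N -> measurable B ->
  <<s events_avoiding n >> (noise_term a i @^-1` B).
Proof.
move=> ni mB.
suff : measurable_fun [set: g_sigma_algebraType (events_avoiding n)]
    (noise_term a i : g_sigma_algebraType (events_avoiding n) -> R).
  by move=> /(_ measurableT B mB); rewrite setTI.
rewrite /noise_term /along; case ex: (pickle_inv i) => [x|] /=; last first.
  exact: measurable_cst.
apply: measurable_funM; first exact: measurable_cst.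
move=> _ C mC; rewrite setTI; apply: sub_sigma_algebra.
exists [:: x], (fun=> C); split => //.
(* By [pickle_invK] a security has a single index, so the one at [i < n] is not the one at [n]. *)
- move=> y; rewrite inE => /eqP ->; apply/eqP => exn.
  have pe m : pickle_inv m = Some x -> pickle x = m.
    by move=> e; have := @pickle_invK X m; rewrite /oapp e.
  by move: ni; rewrite -(pe _ ex) -(pe _ exn) ltnn.
- apply/seteqP; split => [w Cw y /=|w]; first by rewrite inE => /eqP ->.
  by apply; rewrite /= inE.
Qed.

(** Independence splits off the factor of the [n]-th noise, whose law is centred normal and so
    invariant under negation. At an index without a security the term is 0. *)
Lemma noise_symmetric a n (A : set Omega) (B : set R) :
  events_avoiding n A -> measurable B ->
  P (A `&` noise_term a n @^-1` B) =
  P (A `&` (fun o => - noise_term a n o) @^-1` B).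
Proof.
case: noise => gauss indep [s [C [us mC ns ->]]] mB.
rewrite /noise_term /along; case ex: (pickle_inv n) => [x|] /=; last first.
  by congr (P (_ `&` _)); apply/seteqP; split => o; rewrite /preimage/= oppr0.
(* Pulling [B] back along multiplication by [a x] turns the claim into one about [eps x] itself,
   with no case distinction on [a x = 0]. *)
pose D := (fun y : R => a x * y) @^-1` B.
have mNR : measurable_fun [set: R] (-%R : R -> R) by [].
have mD : measurable D.
  rewrite -[D]setTI; suff: measurable_fun setT (fun y : R => a x * y) by apply.
  by apply: measurable_funM => //; exact: measurable_cst.
have mND : measurable (-%R @^-1` D).
  by rewrite -[X in measurable X]setTI; exact: mNR.
have xs : x \notin s by apply/negP => /ns; rewrite ex eqxx.
have key E : measurable E ->
    P (\bigcap_(y in [set` s]) eps y @^-1` C y `&` eps x @^-1` E) =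
    (\prod_(y <- s) P (eps y @^-1` C y) * normal_prob 0 (noise_sd M x) E)%E.
  move=> mE; pose C' y := if y == x then E else C y.
  have := indep (x :: s) C'; rewrite /= xs us => /(_ isT).
  rewrite big_cons /C' eqxx => e.
  rewrite muleC -gauss//.
  transitivity (P (\bigcap_(y in [set` x :: s]) (eps y @^-1` C' y))).
    congr (P _); apply/seteqP; split => o.
      move=> [sC xE] y /=; rewrite inE /C' => /predU1P[->|ys].
        by rewrite eqxx.
      by rewrite (negbTE (memPn xs y ys)); exact: sC.
    move=> h; split => [y /= ys|].
      have := h y; rewrite /C' /= (negbTE (memPn xs y ys)); apply.
      by rewrite inE ys orbT.
    by have := h x; rewrite /C' /= eqxx; apply; rewrite inE eqxx.
  rewrite e; last by move=> y; case: ifP.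
  congr (_ * _)%E; rewrite big_seq [RHS]big_seq; apply: eq_bigr => y ys.
  by rewrite (negbTE (memPn xs y ys)).
transitivity (P (\bigcap_(y in [set` s]) eps y @^-1` C y `&` eps x @^-1` D)) => //.
rewrite key// -normal_prob_opp// ?gt_eqF ?noise_sd_gt0// -key//.
by congr (P (_ `&` _)); apply/seteqP; split => o; rewrite /D /preimage/= mulrN.
Qed.

Lemma noise_term_second_moment a n :
  (\int[P]_o (noise_term a n o ^+ 2)%:E <=
   (along (fun x => 4 * Num.sqrt 2 * (a x * noise_sd M x) ^+ 2) n)%:E)%E.
Proof.
case: noise => gauss _.
rewrite /noise_term /along; case: (pickle_inv n) => [x|] /=; last first.
  by rewrite (eq_integral (cst 0%E)) ?integral0// => o _; rewrite expr0n.
under eq_integral do rewrite exprMn EFinM.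
have mX : measurable_fun [set: R] (fun y : R => (y ^+ 2)%:E).
  by apply/measurable_EFinP; exact: measurable_funX.
rewrite ge0_integralZl//; last 3 first.
- by apply: (measurableT_comp mX).
- by move=> o _; rewrite lee_fin sqr_ge0.
- by rewrite lee_fin sqr_ge0.
have -> : 4 * Num.sqrt 2 * (a x * noise_sd M x) ^+ 2 =
  a x ^+ 2 * (4 * Num.sqrt 2 * noise_sd M x ^+ 2) by ring.
rewrite [leRHS]EFinM; apply: lee_pmul => //.
- by rewrite lee_fin sqr_ge0.
- by apply: integral_ge0 => o _; rewrite lee_fin sqr_ge0.
have h := normal_prob_second_moment (noise_sd_gt0 M x); apply: le_trans h.
rewrite le_eqVlt; apply/orP; left; apply/eqP.
have me : measurable_fun setT (eps x : Omega -> measurableTypeR R).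
  by move=> _ B mB; rewrite setTI; exact: measurable_preimage_eps.
pose e : {mfun Omega >-> measurableTypeR R} :=
  HB.pack (eps x : Omega -> measurableTypeR R)
    (isMeasurableFun.Build _ _ _ _ _ me).
rewrite -(@ge0_integral_distribution _ _ _ _ _ P e
  (fun y => (y ^+ 2)%:E))//; last first.
  by move=> y; rewrite lee_fin sqr_ge0.
by apply: eq_measure_integral => A mA _; exact: gauss.
Qed.

Lemma ae_noise_cvg (a : X -> R) :
  xsummable (fun x => (a x * noise_sd M x) ^+ 2) ->
  {ae P, forall o, xsummable (fun x => a x * eps x o)}.
Proof.
move=> ca; apply: (@ae_cvg_series_symmetric _ _ _ P (noise_term a) events_avoiding
  (along (fun x => 4 * Num.sqrt 2 * (a x * noise_sd M x) ^+ 2))).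
- exact: measurable_noise_term.
- exact: events_avoiding_setI.
- exact: events_avoidingT.
- exact: measurable_events_avoiding.
- by move=> n i B ni mB; exact: noise_term_events_avoiding.
- by move=> n A B; exact: noise_symmetric.
- exact: noise_term_second_moment.
rewrite (_ : along _ =
    (4 * Num.sqrt 2) *: along (fun x => (a x * noise_sd M x) ^+ 2)).
  exact: is_cvg_seriesZ.
apply/funext => n.
change (along (fun x => 4 * Num.sqrt 2 * (a x * noise_sd M x) ^+ 2) n =
  4 * Num.sqrt 2 * along (fun x => (a x * noise_sd M x) ^+ 2) n).
by rewrite /along; case: pickle_inv => [x|]//=; rewrite mulr0.
Qed.

End gaussian_series.

(** * Series over X, measurability and the softmax *)

Section sums.
Context {R : realType} {X : countType}.
Implicit Types f g : X -> R.

Lemma series_along f n :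
  series (along f) n = \sum_(i < n) oapp f 0 (pickle_inv i).
Proof. by rewrite /series/= big_mkord. Qed.

Lemma xsummableP f : xsummable f -> has_xsum f (xsum f).
Proof. by []. Qed.

Lemma has_xsum_summable f s : has_xsum f s -> xsummable f.
Proof. by move=> fs; apply/cvg_ex; exists s. Qed.

Lemma has_xsumE f s : has_xsum f s -> xsum f = s.
Proof. exact: cvg_lim. Qed.

Lemma has_xsumD f g s t :
  has_xsum f s -> has_xsum g t -> has_xsum (fun x => f x + g x) (s + t).
Proof.
move=> fs gt; rewrite /has_xsum.
rewrite (_ : series _ = series (along f) + series (along g)).
  exact: cvgD.
apply/funext => n; rewrite fctE !series_along -big_split/=; apply: eq_bigr => i _.
by case: pickle_inv => //=; rewrite addr0.
Qed.

Lemma has_xsumZ c f s : has_xsum f s -> has_xsum (fun x => c * f x) (c * s).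
Proof.
move=> fs; rewrite /has_xsum (_ : series _ = (fun n => c * series (along f) n)).
  exact: cvgMr.
apply/funext => n; rewrite !series_along mulr_sumr; apply: eq_bigr => i _.
by case: pickle_inv => //=; rewrite mulr0.
Qed.

Lemma has_xsum_sum (I : Type) (r : seq I) (F : I -> X -> R) (s : I -> R) :
  (forall i, has_xsum (F i) (s i)) ->
  has_xsum (fun x => \sum_(i <- r) F i x) (\sum_(i <- r) s i).
Proof.
move=> Fs; elim: r => [|i r IH].
  rewrite big_nil /has_xsum (_ : series _ = cst 0); first exact: cvg_cst.
  apply/funext => n; rewrite series_along big1// => i _.
  by case: pickle_inv => //= x; rewrite big_nil.
rewrite big_cons (_ : (fun x => _) = fun x => F i x + \sum_(i <- r) F i x).
  exact: has_xsumD.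
by apply/funext => x; rewrite big_cons.
Qed.

Lemma abs_summable_le f g : (forall x, `|f x| <= g x) -> xsummable g ->
  abs_summable f.
Proof.
move=> fg; apply: series_le_cvg => n; rewrite /along; case: pickle_inv => //= x.
exact: le_trans (fg x).
Qed.

Lemma abs_summable_summable f : abs_summable f -> xsummable f.
Proof.
move=> af; apply: normed_cvg; move: af; rewrite /abs_summable /xsummable.
rewrite (_ : along (fun x => `|f x|) = (fun n => `|along f n|))//.
by apply/funext => n; rewrite /along; case: pickle_inv => //=; rewrite normr0.
Qed.

Lemma abs_summableD f g : abs_summable f -> abs_summable g ->
  abs_summable (fun x => f x + g x).
Proof.
move=> sf sg; apply: (@abs_summable_le _ (fun x => `|f x| + `|g x|)) => [x|].
  exact: ler_normD.
exact: has_xsum_summable (has_xsumD (xsummableP sf) (xsummableP sg)).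
Qed.

Lemma abs_summableZ c f : abs_summable f -> abs_summable (fun x => c * f x).
Proof.
move=> sf; apply: (@abs_summable_le _ (fun x => `|c| * `|f x|)) => [x|].
  by rewrite normrM.
exact: has_xsum_summable (has_xsumZ (c := `|c|) (xsummableP sf)).
Qed.

Lemma abs_summable_sum (I : Type) (r : seq I) (F : I -> X -> R) :
  (forall i, abs_summable (F i)) -> abs_summable (fun x => \sum_(i <- r) F i x).
Proof.
move=> sF; apply: (@abs_summable_le _ (fun x => \sum_(i <- r) `|F i x|)) => [x|].
  exact: ler_norm_sum.
exact: has_xsum_summable (has_xsum_sum (r := r) (fun i => xsummableP (sF i))).
Qed.

End sums.

(** By completeness, convergence is the Cauchy property, which quantifiers over natural numbers
    express; the set is a countable combination of measurable ones. *)
Lemma measurable_cvgn d (T : measurableType d) (R : realType)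
    (u : nat -> T -> R) : (forall n, measurable_fun setT (u n)) ->
  measurable [set t | cvgn (u ^~ t)].
Proof.
move=> mu.
rewrite (_ : [set t | _] = \bigcap_j \bigcup_m \bigcap_k
    [set t | `|u (m + k)%N t - u m t| <= j.+1%:R^-1]).
  apply: bigcapT_measurable => j; apply: bigcupT_measurable => m.
  apply: bigcapT_measurable => k.
  have mf : measurable_fun setT (fun t => `|u (m + k)%N t - u m t|).
    by apply: measurableT_comp => //; exact: measurable_funB.
  rewrite (_ : [set t | _] = setT `&`
      (fun t => `|u (m + k)%N t - u m t|) @^-1` `]-oo, j.+1%:R^-1]%classic).
    by apply: mf => //; exact: measurable_itv.
  by apply/seteqP; split => t /=; rewrite in_itv/= => // -[].
apply/seteqP; split => t /=.
  move=> /cvg_ex[l ul] j _.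
  have e0 : (0 : R) < j.+1%:R^-1 / 2 by rewrite divr_gt0 ?invr_gt0.
  have /cvgrPdist_le/(_ _ e0)[m _ ml] := ul.
  exists m => // k _ /=; rewrite [X in _ <= X]splitr.
  rewrite -[_ - _](subrKA l) (le_trans (ler_normD _ _))// lerD//.
    by rewrite distrC; apply: ml => /=; exact: leq_addr.
  by apply: ml => /=.
move=> h; apply/cauchy_cvgP/cauchy_exP => e e0.
have [j je] : exists j : nat, j.+1%:R^-1 < e.
  exists (Num.truncn e^-1); rewrite invf_plt ?posrE//; exact: truncnS_gt.
have [m _ hm] := h j I.
exists (u m t); exists m => // n /= mn; rewrite /ball/= distrC.
by apply: le_lt_trans je; have := hm (n - m)%N I; rewrite /= subnKC.
Qed.

Lemma measurable_limn d (T : measurableType d) (R : realType)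
    (u : nat -> T -> R) : (forall n, measurable_fun setT (u n)) ->
  measurable_fun setT (fun t => limn (u ^~ t)).
Proof.
move=> mu; have mC := measurable_cvgn mu.
rewrite -(setUv [set t | cvgn (u ^~ t)]); apply/measurable_funU => //.
  exact: measurableC.
split.
  by apply: (@measurable_fun_cvg _ _ _ _ u) => // m; exact: measurable_funTS.
(* On the set of divergence [limn] is the default [point], hence constant. *)
apply: (@eq_measurable_fun _ _ _ _ _ (cst point)) => [t|]; last first.
  exact: measurable_cst.
by rewrite inE /= => /dvgP ->.
Qed.

Lemma measurable_xsum d (T : measurableType d) (R : realType) (X : countType)
    (f : X -> T -> R) : (forall x, measurable_fun setT (f x)) ->
  measurable_fun setT (fun t => xsum (f ^~ t)).
Proof.
move=> mf.
apply: (@measurable_limn _ _ _ (fun n t => series (along (f ^~ t)) n)) => n.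
rewrite (_ : (fun t => _) = fun t => \sum_(i < n) oapp (f ^~ t) 0 (pickle_inv i)).
  apply: measurable_sum => i; case: pickle_inv => [x|] /=; last exact: measurable_cst.
  exact: mf.
by apply/funext => t; rewrite series_along.
Qed.

(** * The softmax: derivative and uniform bounds *)

Section softmax.
Context {R : realType} {S : finType}.
Implicit Types a h : S -> R.

Definition softmax a h (l : S) (t : R) : R :=
  expR (t * h l) * a l / \sum_m expR (t * h m) * a m.

Lemma is_derive_bigsum (r : seq S) (f : S -> R -> R) (df : S -> R) (t : R) :
  (forall l, is_derive t (1 : R) (f l) (df l)) ->
  is_derive t (1 : R) (fun t => \sum_(l <- r) f l t) (\sum_(l <- r) df l).
Proof.
move=> fd; elim: r => [|l r IH].
  rewrite big_nil (_ : (fun t => _) = cst 0); first exact: is_derive_cst.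
  by apply/funext => u; rewrite big_nil.
rewrite big_cons (_ : (fun t => _) = f l + (fun t => \sum_(l <- r) f l t)).
  exact: is_deriveD.
by apply/funext => u; rewrite big_cons.
Qed.

Section nonzero_weights.
Variables (a h : S -> R).
Hypotheses (a0 : forall l, 0 <= a l) (sa0 : 0 < \sum_l a l).

Lemma softmax_weight_gt0 t : 0 < \sum_m expR (t * h m) * a m.
Proof.
have [l al] : exists l, 0 < a l.
  apply/existsP; move: sa0; apply: contraTT; rewrite negb_exists => /forallP al.
  by rewrite -leNgt sumr_le0// => l _; rewrite leNgt.
rewrite (bigD1 l)//= ltr_pwDl ?mulr_gt0 ?expR_gt0//.
by apply: sumr_ge0 => m _; rewrite mulr_ge0// expR_ge0.
Qed.

Lemma softmax_ge0 l t : 0 <= softmax a h l t.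
Proof. by rewrite divr_ge0 ?mulr_ge0 ?expR_ge0// ltW// softmax_weight_gt0. Qed.

Lemma softmax_sum1 t : \sum_l softmax a h l t = 1.
Proof. by rewrite -mulr_suml divff// gt_eqF// softmax_weight_gt0. Qed.

Lemma softmax_le1 l t : softmax a h l t <= 1.
Proof.
rewrite -(softmax_sum1 t) (bigD1 l)//= lerDl.
by apply: sumr_ge0 => m _; exact: softmax_ge0.
Qed.

Lemma is_derive_softmax l t : is_derive t (1 : R) (softmax a h l)
  (softmax a h l t * (h l - \sum_m h m * softmax a h m t)).
Proof.
have de m : is_derive t (1 : R) (fun t => expR (t * h m) * a m)
    (expR (t * h m) * h m * a m).
  have d1 : is_derive t (1 : R) (fun t : R => t * h m) (h m).
    by apply: is_derive_eq; rewrite /GRing.scale/= mulr0 mulr1 add0r.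
  have d2 : is_derive t (1 : R) (fun t => expR (t * h m)) (expR (t * h m) * h m).
    exact: (@is_derive1_comp _ expR (fun t : R => t * h m)).
  by apply: is_derive_eq; rewrite /GRing.scale/= mulr0 add0r mulrC.
have W0 : \sum_m expR (t * h m) * a m != 0 by rewrite gt_eqF// softmax_weight_gt0.
have dW := is_derive_bigsum (index_enum S) de.
have dV := is_deriveV W0 dW.
have dM := is_deriveM (de l) dV.
apply: (is_derive_eq dM); rewrite /GRing.scale/= /softmax.
set W := \sum_m _ in W0 *; set e := expR (t * h l) * a l.
have -> : \sum_m h m * (expR (t * h m) * a m / W) =
    (\sum_m expR (t * h m) * h m * a m) / W.
  by rewrite mulr_suml; apply: eq_bigr => m _; ring.
by rewrite /e; field.
Qed.

(** Both [h l] and the softmax mean of [h] are bounded by the sum of the [|h m|]. The bound depends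
    on neither [a] nor [t], so it can dominate under the expectation. *)
Lemma softmax_derive_le l t :
  `|softmax a h l t * (h l - \sum_m h m * softmax a h m t)| <= 2 * \sum_m `|h m|.
Proof.
rewrite normrM ger0_norm ?softmax_ge0//.
rewrite (le_trans (ler_piMl (normr_ge0 _) (softmax_le1 _ _)))//.
rewrite (le_trans (ler_normB _ _))// mulr_natl mulr2n lerD//.
  by rewrite (bigD1 l)//= lerDl sumr_ge0.
rewrite (le_trans (ler_norm_sum _ _ _))//; apply: ler_sum => m _.
by rewrite normrM (ger0_norm (softmax_ge0 m t)) ler_piMr// softmax_le1.
Qed.

End nonzero_weights.
End softmax.

(** * Posteriors and prices *)

Section bounded_integrands.
Context {R : realType} {d : measure_display} {T : measurableType d}
        (P : probability T R).
Implicit Type f : T -> R.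

(** On nonnegative reals, inversion with the convention that 0 is its own inverse is the measurable
    power function of exponent -1. *)
Lemma measurable_funV_ge0 d' (T' : measurableType d') (f : T' -> R) :
  measurable_fun setT f -> (forall t, 0 <= f t) ->
  measurable_fun setT (fun t => (f t)^-1).
Proof.
move=> mf f0; rewrite (_ : (fun t => _) = fun t => f t `^ (-1)).
  exact: (measurableT_comp (@measurable_powR R (-1)) mf).
by apply/funext => t; rewrite powR_inv1.
Qed.

Lemma bounded_integrable f C : measurable_fun setT f ->
  (forall t, `|f t| <= C) -> P.-integrable setT (EFin \o f).
Proof.
move=> mf fC; apply: measurable_bounded_integrable => //.
  by rewrite -ge0_fin_numE// fin_num_measure.
exists C; split; first exact: num_real.
by move=> c Cc t _; apply: le_trans (fC t) (ltW Cc).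
Qed.

(** A zero integral would make [f] vanish almost everywhere; as [f] vanishes nowhere, the whole
    space would be null, against total mass 1. *)
Lemma Rintegral_gt0 f C : measurable_fun setT f -> (forall t, 0 < f t) ->
  (forall t, f t <= C) -> 0 < \int[P]_t f t.
Proof.
move=> mf f0 fC; have int_f : P.-integrable setT (EFin \o f).
  by apply: (@bounded_integrable f C) => // t; rewrite ger0_norm// ltW.
rewrite lt_neqAle Rintegral_ge0 ?andbT => [|t _]; last exact: ltW.
apply/negP => /eqP I0.
have E0 : (\int[P]_t `|(f t)%:E| = 0)%E.
  rewrite (eq_integral (EFin \o f)) => [|t _]; last first.
    by rewrite gee0_abs// lee_fin ltW.
  have fin : (\int[P]_t (EFin \o f) t)%E \is a fin_num.
    by apply: integrable_fin_num.
  by rewrite -(fineK fin); congr EFin; exact/esym.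
have mE : measurable_fun setT (EFin \o f) by exact/measurable_EFinP.
have /(ae_eq_integral_abs P measurableT mE) [N [mN N0 sN]] := E0.
have NT : N = setT.
  apply/seteqP; split => // t _; apply: sN => /= h.
  by have [ft] := h I; have := f0 t; rewrite ft ltxx.
have := @probability_setT _ _ _ P; rewrite -NT (N0 : P N = 0%E) => /eqP.
by rewrite eq_sym onee_eq0.
Qed.

End bounded_integrands.

(** * The posterior as a softmax along a line of order flows *)

Section pricing.
Context {R : realType} {X : countType} {S : finType} (M : market R X S)
        (Wt : X -> S -> R).
Implicit Types (W v w : X -> R).

(** Comparison through [|f g| <= f^2 + g^2]. *)
Lemma portfolio_summable_mul f g : portfolio M f -> portfolio M g ->
  abs_summable (fun x => f x * g x / noise_sd M x ^+ 2).
Proof.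
move=> sf sg; apply: (abs_summable_le _ (has_xsum_summable
  (has_xsumD (xsummableP sf) (xsummableP sg)))) => x.
rewrite normrM (@ger0_norm _ (_^-1)) ?invr_ge0 ?sqr_ge0// -mulrDl.
rewrite ler_wpM2r ?invr_ge0 ?sqr_ge0//.
by rewrite ler_norml; apply/andP; split; nra.
Qed.

Lemma portfolioD W v t : portfolio M W -> portfolio M v ->
  portfolio M (fun x => W x + t * v x).
Proof.
move=> sW sv; apply: abs_summable_summable.
apply: (abs_summable_le _ (has_xsum_summable (has_xsumD
  (has_xsumZ (c := 2) (xsummableP sW))
  (has_xsumZ (c := 2 * t ^+ 2) (xsummableP sv))))) => x.
have s2 : 0 <= (noise_sd M x ^+ 2)^-1 by rewrite invr_ge0 sqr_ge0.
rewrite ger0_norm; last by rewrite mulr_ge0// sqr_ge0.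
rewrite !mulrA -mulrDl ler_wpM2r//.
by have := sqr_ge0 (W x - t * v x); nra.
Qed.

(** Where one of these series diverges, [xsum] returns a default value: the posterior is still a
    probability vector, but linearity of the log-likelihoods along [w + t v] is claimed only on this
    set. *)
Definition likelihood_defined w :=
  forall l, xsummable (fun x => Wt x l * w x / noise_sd M x ^+ 2).

Definition weight w (l : S) : R := likelihood M Wt l w * prior M l.

Lemma weight_ge0 w l : 0 <= weight w l.
Proof. by rewrite mulr_ge0 ?expR_ge0 ?prior_ge0. Qed.

Lemma weight_sum_gt0 w : 0 < \sum_l weight w l.
Proof.
have [l pl] : exists l, 0 < prior M l.
  apply/existsP; apply: contraT; rewrite negb_exists => /forallP p0.
  have := prior_sum1 M; rewrite big1 => [/esym/eqP|l _]; first by rewrite oner_eq0.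
  by apply/eqP; rewrite eq_le prior_ge0 andbT leNgt.
rewrite (bigD1 l)//= ltr_pwDl ?mulr_gt0 ?expR_gt0//.
by apply: sumr_ge0 => m _; exact: weight_ge0.
Qed.

(** At time 0 the slopes [h] are arbitrary, so the sign, mass and slope bounds of the softmax pass
    to the posterior at every flow, convergent or not. *)
Lemma posterior_softmax0 (h : S -> R) w l :
  posterior M Wt l w = softmax (weight w) h l 0.
Proof.
rewrite /posterior /softmax mul0r expR0 mul1r; congr (_ / _).
by apply: eq_bigr => m _; rewrite mul0r expR0 mul1r.
Qed.

Lemma posterior_ge0 w l : 0 <= posterior M Wt l w.
Proof.
rewrite (posterior_softmax0 (fun=> 0)).
by apply: softmax_ge0; [exact: weight_ge0|exact: weight_sum_gt0].
Qed.

Lemma posterior_sum1 w : \sum_l posterior M Wt l w = 1.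
Proof.
under eq_bigr do rewrite (posterior_softmax0 (fun=> 0)).
by apply: softmax_sum1; [exact: weight_ge0|exact: weight_sum_gt0].
Qed.

Lemma posterior_le1 w l : posterior M Wt l w <= 1.
Proof.
rewrite (posterior_softmax0 (fun=> 0)).
by apply: softmax_le1; [exact: weight_ge0|exact: weight_sum_gt0].
Qed.

Lemma posterior_gt0 w l : 0 < prior M l -> 0 < posterior M Wt l w.
Proof.
by move=> pl; rewrite divr_gt0 ?mulr_gt0 ?expR_gt0 ?weight_sum_gt0.
Qed.

Lemma posterior_eq0 w l : prior M l = 0 -> posterior M Wt l w = 0.
Proof. by move=> pl; rewrite /posterior pl mulr0 mul0r. Qed.

Lemma posterior_shift w v l t : (forall m, portfolio M (Wt ^~ m)) ->
  portfolio M v -> likelihood_defined w ->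
  posterior M Wt l (fun x => w x + t * v x) =
  softmax (weight w) (insider_exposure M Wt v) l t.
Proof.
move=> sWt sv dw.
have lik m : likelihood M Wt m (fun x => w x + t * v x) * prior M m =
    expR (t * insider_exposure M Wt v m) * weight w m.
  rewrite /weight mulrA; congr (_ * _); rewrite /likelihood -expRD; congr expR.
  have sh := abs_summable_summable (portfolio_summable_mul (sWt m) sv).
  have := has_xsumD (xsummableP (dw m)) (has_xsumZ (c := t) (xsummableP sh)).
  rewrite (_ : (fun x => _) =
      fun x => Wt x m * (w x + t * v x) / noise_sd M x ^+ 2).
    by move=> /has_xsumE ->; rewrite /insider_exposure; ring.
  by apply/funext => x; ring.
by rewrite /posterior /softmax lik; under eq_bigr do rewrite lik.
Qed.

(** With [h] the exposure of [v], this is the derivative at 0 of the posterior along [w + t v], for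
    [w] with convergent log-likelihoods. *)
Definition posterior_slope (h : S -> R) (l : S) (w : X -> R) : R :=
  posterior M Wt l w * (h l - posterior_mean M Wt h w).

Lemma posterior_slope_le h l w : `|posterior_slope h l w| <= 2 * \sum_m `|h m|.
Proof.
rewrite /posterior_slope /posterior_mean.
under eq_bigr do rewrite (posterior_softmax0 h).
rewrite (posterior_softmax0 h).
by apply: softmax_derive_le; [exact: weight_ge0|exact: weight_sum_gt0].
Qed.

Lemma posterior_covE (f g : S -> R) w :
  posterior_cov M Wt f g w = \sum_l f l * posterior_slope g l w.
Proof.
rewrite /posterior_cov {1}/posterior_mean.
set fm := posterior_mean M Wt f w; set gm := posterior_mean M Wt g w.
(* The centred [g] has posterior mean 0, so the mean of [f] multiplies a vanishing sum. *)
have g0 : \sum_l (g l - gm) * posterior M Wt l w = 0.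
  under eq_bigr do rewrite mulrBl.
  by rewrite sumrB -mulr_sumr posterior_sum1 mulr1 subrr.
transitivity (\sum_l f l * posterior_slope g l w -
    fm * \sum_l (g l - gm) * posterior M Wt l w); last by rewrite g0 mulr0 subr0.
rewrite mulr_sumr -sumrB; apply: eq_bigr => l _.
by rewrite /posterior_slope -/gm; ring.
Qed.

Lemma is_gateaux_price w v x : (forall m, portfolio M (Wt ^~ m)) ->
  portfolio M v -> likelihood_defined w ->
  is_gateaux (price M Wt x) w v (price_impact M Wt v x w).
Proof.
move=> sWt sv dw; rewrite /is_gateaux.
set h := insider_exposure M Wt v.
rewrite (_ : (fun t => _) = fun t =>
    \sum_l payoff M x l * softmax (weight w) h l t); last first.
  by apply/funext => t; apply: eq_bigr => l _; rewrite posterior_shift.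
rewrite /price_impact posterior_covE; apply: is_derive_bigsum => l.
have d := is_derive_softmax h (@weight_ge0 w) (weight_sum_gt0 w) l 0.
have dc := is_deriveZ (payoff M x l) d.
apply: (is_derive_eq dc); rewrite /GRing.scale/= /posterior_slope /posterior_mean.
under [in RHS]eq_bigr do rewrite (posterior_softmax0 h).
by rewrite (posterior_softmax0 h).
Qed.

Lemma measurable_coordinate x :
  measurable_fun [set: order_flow R X] (fun w : order_flow R X => w x).
Proof.
move=> _ B mB; rewrite setTI; apply: sub_sigma_algebra.
by exists x, B; split.
Qed.

Lemma measurable_weight l :
  measurable_fun [set: order_flow R X] (fun w : order_flow R X => weight w l).
Proof.
apply: measurable_funM; last exact: measurable_cst.
apply: (measurableT_comp (@measurable_expR R)).
apply: measurable_funB; last exact: measurable_cst.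
apply: (@measurable_xsum _ _ _ _
  (fun x (w : order_flow R X) => Wt x l * w x / noise_sd M x ^+ 2)) => x.
apply: measurable_funM; last exact: measurable_cst.
apply: measurable_funM; first exact: measurable_cst.
exact: measurable_coordinate.
Qed.

Lemma measurable_likelihood_defined :
  measurable ([set w | likelihood_defined w] : set (order_flow R X)).
Proof.
rewrite (_ : [set w | _] = \bigcap_(l in [set: S])
  [set w | xsummable (fun x => Wt x l * w x / noise_sd M x ^+ 2)]); last first.
  by apply/seteqP; split => w h l; [move=> _; exact: h|exact: h].
apply: fin_bigcap_measurable => [|l _]; first exact: finite_finset.
apply: (@measurable_cvgn _ (order_flow R X) R (fun n w =>
  series (along (fun x => Wt x l * w x / noise_sd M x ^+ 2)) n)) => n.
rewrite (_ : (fun t => _) = fun w : order_flow R X =>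
    \sum_(i < n) oapp (fun x => Wt x l * w x / noise_sd M x ^+ 2) 0 (pickle_inv i)).
  apply: measurable_sum => i; case: pickle_inv => [x|] /=; last exact: measurable_cst.
  apply: measurable_funM; last exact: measurable_cst.
  apply: measurable_funM; first exact: measurable_cst.
  exact: measurable_coordinate.
by apply/funext => w; rewrite series_along.
Qed.

Lemma measurable_softmax d (T : measurableType d) (a : T -> S -> R)
    (h : S -> R) l t :
  (forall m, measurable_fun setT (a ^~ m)) -> (forall u m, 0 <= a u m) ->
  measurable_fun setT (fun u => softmax (a u) h l t).
Proof.
move=> ma a0; have me m : measurable_fun setT (fun u => expR (t * h m) * a u m).
  by apply: measurable_funM => //; exact: measurable_cst.
apply: measurable_funM => //; apply: measurable_funV_ge0.
  by apply: measurable_sum.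
by move=> u; apply: sumr_ge0 => m _; rewrite mulr_ge0 ?expR_ge0.
Qed.

Lemma measurable_posterior l :
  measurable_fun [set: order_flow R X] (posterior M Wt l : order_flow R X -> R).
Proof.
rewrite (_ : posterior M Wt l = fun w => softmax (weight w) (fun=> 0) l 0).
  apply: measurable_softmax => [m|w m]; first exact: measurable_weight.
  exact: weight_ge0.
by apply/funext => w; exact: posterior_softmax0.
Qed.

Lemma measurable_posterior_slope h l :
  measurable_fun [set: order_flow R X]
    (posterior_slope h l : order_flow R X -> R).
Proof.
apply: measurable_funM; first exact: measurable_posterior.
apply: measurable_funB; first exact: measurable_cst.
apply: measurable_sum => m; apply: measurable_funM; first exact: measurable_cst.
exact: measurable_posterior.
Qed.

End pricing.

(** * Expectations and the first-order condition *)

Section insider.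
Context {R : realType} {X : countType} {S : finType} (M : market R X S)
  {d : measure_display} {Omega : measurableType d} {P : probability Omega R}
  (eps : X -> {RV P >-> R}) (k : S) (Wt : X -> S -> R).
Hypothesis noise : gaussian_noise M eps.
Hypothesis sWt : forall l : S, portfolio M (fun x => Wt x l).
Implicit Types W v : X -> R.

Lemma ae_likelihood_defined W : portfolio M W ->
  {ae P, forall o, likelihood_defined M Wt (realized_flow eps W o)}.
Proof.
move=> sW; apply: filter_forall => l.
(* The noise part of the log-likelihood has coefficients [Wt x l / noise_sd M x ^+ 2]; its variances
   are the terms of the square-summability of the belief. *)
have sa : xsummable (fun x => (Wt x l / noise_sd M x ^+ 2 * noise_sd M x) ^+ 2).
  rewrite (_ : (fun x => _) = fun x => Wt x l ^+ 2 / noise_sd M x ^+ 2).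
    exact: sWt.
  by apply/funext => x; field; rewrite gt_eqF// noise_sd_gt0.
apply: filterS (ae_noise_cvg noise sa) => o co.
have sh := abs_summable_summable (portfolio_summable_mul (@sWt l) sW).
have := has_xsum_summable (has_xsumD (xsummableP sh) (xsummableP co)).
rewrite (_ : (fun x => _) =
  fun x => Wt x l * realized_flow eps W o x / noise_sd M x ^+ 2)//.
by apply/funext => x; rewrite /realized_flow; ring.
Qed.

Section flow_mean.
Variables (f : order_flow R X -> R) (C : R).
Hypotheses (mf : measurable_fun setT f) (fC : forall w, `|f w| <= C).

Lemma measurable_comp_realized_flow W :
  measurable_fun setT (fun o => f (realized_flow eps W o)).
Proof.
exact: (measurableT_comp mf (@measurable_realized_flow _ _ _ _ _ eps W)).
Qed.

Lemma integrable_comp_realized_flow W :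
  P.-integrable setT (EFin \o (fun o => f (realized_flow eps W o))).
Proof.
exact: bounded_integrable (measurable_comp_realized_flow W) (fun o => fC _).
Qed.

(** On [Omega] the measure is fixed and [W] enters through the integrand, the form needed to
    differentiate under the integral. *)
Lemma flow_meanE W : flow_mean eps W f = \int[P]_o f (realized_flow eps W o).
Proof.
rewrite /flow_mean /Rintegral unlock; congr fine.
rewrite (@integral_distribution _ _ _ _ _ P (realized_flow eps W) (EFin \o f))//.
  exact/measurable_EFinP.
exact: integrable_comp_realized_flow.
Qed.

End flow_mean.

Lemma flow_mean_lincomb (c : S -> R) (f : S -> order_flow R X -> R) C W :
  (forall l, measurable_fun setT (f l)) -> (forall l w, `|f l w| <= C) ->
  flow_mean eps W (fun w => \sum_l c l * f l w) =
  \sum_l c l * flow_mean eps W (f l).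
Proof.
move=> mf fC.
have mcf l : measurable_fun setT (fun w => c l * f l w).
  by apply: measurable_funM => //; exact: measurable_cst.
have cfC l w : `|c l * f l w| <= (\sum_l `|c l|) * C.
  rewrite normrM ler_pM// (bigD1 l)//= lerDl; exact: sumr_ge0.
rewrite (@flow_meanE _ (\sum_(l : S) (\sum_l `|c l|) * C)); last 2 first.
- exact: measurable_sum.
- move=> w; rewrite (le_trans (ler_norm_sum _ _ _))//; exact: ler_sum.
under eq_bigr do rewrite (flow_meanE (mf _) (fC _)).
elim: (index_enum S) => [|l r IH].
  by under eq_Rintegral do rewrite big_nil; rewrite Rintegral_cst// mul0r big_nil.
under eq_Rintegral do rewrite big_cons.
rewrite big_cons -IH -RintegralZl//; last first.
  exact: integrable_comp_realized_flow (mf l) (fC l) W.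
rewrite RintegralD//.
  exact: integrable_comp_realized_flow (mcf l) (cfC l) W.
apply: (@integrable_comp_realized_flow (fun w => \sum_(j <- r) c j * f j w)
  (\sum_(l <- r) (\sum_l `|c l|) * C)); first exact: measurable_sum.
by move=> w; rewrite (le_trans (ler_norm_sum _ _ _))//; exact: ler_sum.
Qed.

(** The portfolio enters execution prices only through the finitely many numbers [q W l]; for
    square-summable [W] and [v], [r v W l] is their derivative in direction [v]. *)
Let q W l := flow_mean eps W (posterior M Wt l).
Let r v W l := flow_mean eps W (posterior_slope M Wt (insider_exposure M Wt v) l).

Lemma posterior_bounded l w : `|posterior M Wt l w| <= 1.
Proof. by rewrite ger0_norm ?posterior_ge0// posterior_le1. Qed.

Lemma mean_posteriorE W l :
  q W l = \int[P]_o posterior M Wt l (realized_flow eps W o).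
Proof. exact: flow_meanE (measurable_posterior M Wt l) (posterior_bounded l) W. Qed.

Lemma mean_posterior_gt0 W l : 0 < prior M l -> 0 < q W l.
Proof.
move=> pl; rewrite mean_posteriorE.
apply: (@Rintegral_gt0 _ _ _ _ _ 1).
- exact: (measurable_comp_realized_flow (measurable_posterior M Wt l)).
- by move=> o; exact: posterior_gt0.
- by move=> o; exact: posterior_le1.
Qed.

Lemma mean_posterior_ge0 W l : 0 <= q W l.
Proof.
rewrite mean_posteriorE.
by apply: Rintegral_ge0 => o _; exact: posterior_ge0.
Qed.

Lemma mean_posterior_eq0 W l : prior M l = 0 -> q W l = 0.
Proof.
move=> pl; rewrite mean_posteriorE.
by under eq_Rintegral do rewrite posterior_eq0//; rewrite Rintegral_cst// mul0r.
Qed.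

Lemma mean_slope_eq0 v W l : prior M l = 0 -> r v W l = 0.
Proof.
move=> pl; rewrite /r (flow_meanE (measurable_posterior_slope M Wt _ l)
  (posterior_slope_le M Wt _ l)).
under eq_Rintegral do rewrite /posterior_slope posterior_eq0// mul0r.
by rewrite Rintegral_cst// mul0r.
Qed.

(* Only signals of positive prior enter prices; under the rest the payoffs of
   a portfolio in dom_J need not be summable. *)
Definition live_payoff l x := if prior M l == 0 then 0 else payoff M x l.

Lemma exec_priceE W x : exec_price M eps Wt W x = \sum_l live_payoff l x * q W l.
Proof.
rewrite /exec_price /price (@flow_mean_lincomb _ _ 1).
- apply: eq_bigr => l _; rewrite /live_payoff; case: eqP => // pl.
  by rewrite -/(q W l) mean_posterior_eq0// !mulr0.
- by move=> l; exact: measurable_posterior.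
- by move=> l w; exact: posterior_bounded.
Qed.

Lemma mean_price_impactE v W x :
  mean_price_impact M eps Wt v W x = \sum_l live_payoff l x * r v W l.
Proof.
rewrite /mean_price_impact /price_impact.
rewrite (_ : (fun w => _) = fun w => \sum_l payoff M x l *
  posterior_slope M Wt (insider_exposure M Wt v) l w); last first.
  by apply/funext => w; exact: posterior_covE.
rewrite (@flow_mean_lincomb _ _ (2 * \sum_m `|insider_exposure M Wt v m|)).
- apply: eq_bigr => l _; rewrite /live_payoff; case: eqP => // pl.
  by rewrite -/(r v W l) mean_slope_eq0// !mulr0.
- by move=> l; exact: measurable_posterior_slope.
- by move=> l w; exact: posterior_slope_le.
Qed.

Lemma is_derive_mean_posterior W v l : portfolio M W -> portfolio M v ->
  is_derive (0 : R) (1 : R) (fun t => q (fun x => W x + t * v x) l) (r v W l).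
Proof.
move=> sW sv; set h := insider_exposure M Wt v.
pose a o := weight M Wt (realized_flow eps W o).
(* [F] is a softmax at every outcome, so differentiability and bounds hold everywhere; almost sure
   convergence serves only in [qE], to identify its integral with the mean posterior. *)
pose F t o := softmax (a o) h l t.
have ma m : measurable_fun setT (a ^~ m).
  exact: (measurable_comp_realized_flow (measurable_weight M Wt m)).
have a0 o m : 0 <= a o m by exact: weight_ge0.
have sa0 o : 0 < \sum_m a o m by exact: weight_sum_gt0.
have mF t : measurable_fun setT (F t) by exact: measurable_softmax.
have dF t o : is_derive t (1 : R) (F ^~ o)
    (F t o * (h l - \sum_m h m * softmax (a o) h m t)) by exact: is_derive_softmax.
have qE t : q (fun x => W x + t * v x) l = \int[P]_o F t o.
  rewrite mean_posteriorE /Rintegral.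
  congr fine; apply: ae_eq_integral => //.
  - apply/measurable_EFinP.
    exact: (measurable_comp_realized_flow (measurable_posterior M Wt l)).
  - by apply/measurable_EFinP; exact: mF.
  apply: filterS (ae_likelihood_defined sW) => o dw _; congr EFin.
  rewrite /F /a -posterior_shift//; congr (posterior M Wt l _).
  by apply/funext => x; rewrite /realized_flow addrAC.
have FC t o : `|F t o| <= 1 by rewrite ger0_norm ?softmax_ge0// softmax_le1.
(* A constant dominates, as the exposures of [v] do not depend on the outcome. *)
pose G (o : Omega) := 2 * \sum_m `|h m|.
have intF (t : R) : `]-1, 1[%classic t -> P.-integrable setT (EFin \o F t).
  by move=> _; exact: bounded_integrable (mF t) (FC t).
have derF (t : R) o : `]-1, 1[%classic t -> setT o -> derivable (F ^~ o) t 1.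
  by move=> _ _; exact: (@ex_derive _ _ _ _ _ _ _ (dF t o)).
have G0 o : 0 <= G o by rewrite mulr_ge0// sumr_ge0.
have intG : P.-integrable setT (EFin \o G).
  apply: (@bounded_integrable _ _ _ _ _ (2 * \sum_m `|h m|)) => [|o].
    exact: measurable_cst.
  by rewrite ger0_norm.
have GF (t : R) o : `]-1, 1[%classic t -> setT o -> `|partial1of2 F t o| <= G o.
  move=> _ _; rewrite partial1of2E (@derive_val _ _ _ _ _ _ _ (dF t o)).
  exact: softmax_derive_le.
have I0 : `]-1, 1[%classic (0 : R) by rewrite /= in_itv/= ltrN10 ltr01.
have D := derivable_under_integral measurableT I0 intF derF G0 intG GF.
have V := differentiation_under_integral measurableT I0 intF derF G0 intG GF.
rewrite (_ : (fun t => _) = fun t => \int[P]_o F t o); last by apply/funext.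
apply: DeriveDef => //; rewrite -derive1E V.
rewrite /r (flow_meanE (measurable_posterior_slope M Wt _ l)
  (posterior_slope_le M Wt _ l)).
apply: eq_Rintegral => o _; rewrite partial1of2E (@derive_val _ _ _ _ _ _ _ (dF 0 o)).
rewrite /posterior_slope /posterior_mean -/h (posterior_softmax0 M Wt h).
by congr (_ * (_ - _)); apply: eq_bigr => m _; rewrite (posterior_softmax0 M Wt h).
Qed.

(** * Summability and the objective along a line of portfolios *)

Lemma live_payoff_ge0 l x : 0 <= live_payoff l x.
Proof. by rewrite /live_payoff; case: ifP => // _; exact: payoff_ge0. Qed.

Lemma dom_J_live W : dom_J M eps Wt k W ->
  forall l, abs_summable (fun x => W x * live_payoff l x).
Proof.
move=> [_ _ sp] l; have [pl|pl] := eqVneq (prior M l) 0.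
  rewrite (_ : (fun x => _) = fun x => 0 * (W x * exec_price M eps Wt W x)).
    exact: abs_summableZ.
  by apply/funext => x; rewrite /live_payoff pl eqxx mulr0 mul0r.
have ql : 0 < q W l.
  by apply: mean_posterior_gt0; rewrite lt_neqAle eq_sym pl prior_ge0.
(* The execution price is a sum of nonnegative terms, one of which is [live_payoff l x * q W l];
   dividing by [q W l] gives the dominating series. *)
apply: (abs_summable_le _ (has_xsum_summable
  (has_xsumZ (c := (q W l)^-1) (xsummableP sp)))) => x.
rewrite ler_pdivlMl// mulrC !normrM -mulrA ler_wpM2l//.
rewrite ger0_norm ?live_payoff_ge0// exec_priceE ger0_norm; last first.
  by apply: sumr_ge0 => m _; rewrite mulr_ge0 ?live_payoff_ge0 ?mean_posterior_ge0.
rewrite (bigD1 l)//= lerDl; apply: sumr_ge0 => m _.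
by rewrite mulr_ge0 ?live_payoff_ge0 ?mean_posterior_ge0.
Qed.

Let value W l := xsum (fun x => W x * live_payoff l x).

(** Exchanges the series over securities with the finite sum over signals, for arbitrary [c]: mean
    posteriors give the execution cost, mean slopes the impact term. *)
Lemma has_xsum_mul_live W (c : S -> R) :
  (forall l, abs_summable (fun x => W x * live_payoff l x)) ->
  abs_summable (fun x => W x * \sum_l live_payoff l x * c l) /\
  has_xsum (fun x => W x * \sum_l live_payoff l x * c l) (\sum_l c l * value W l).
Proof.
move=> sW; rewrite (_ : (fun x => _) =
  fun x => \sum_l c l * (W x * live_payoff l x)); last first.
  by apply/funext => x; rewrite mulr_sumr; apply: eq_bigr => l _; ring.
split; first by apply: abs_summable_sum => l; exact: abs_summableZ.
apply: has_xsum_sum => l; apply: has_xsumZ; apply: xsummableP.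
exact: abs_summable_summable.
Qed.

Lemma mul_shift (W v f : X -> R) t :
  (fun x => (W x + t * v x) * f x) = (fun x => W x * f x + t * (v x * f x)).
Proof. by apply/funext => x; ring. Qed.

(** Prices move with the portfolio, so execution costs do not simply add. The live payoffs are the
    same for all portfolios, and summability against them is linear and implies summability against
    any execution price. *)
Lemma dom_J_shift W v t : dom_J M eps Wt k W -> dom_J M eps Wt k v ->
  dom_J M eps Wt k (fun x => W x + t * v x).
Proof.
move=> dW dv; have [pW kW _] := dW; have [pv kv _] := dv; split.
- exact: portfolioD.
- by rewrite mul_shift; apply: abs_summableD => //; exact: abs_summableZ.
rewrite (_ : (fun x => _) = fun x => (W x + t * v x) *
  \sum_l live_payoff l x * q (fun x => W x + t * v x) l); last first.
  by apply/funext => x; rewrite exec_priceE.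
apply: (has_xsum_mul_live _ _).1 => l; rewrite mul_shift.
apply: abs_summableD; first exact: (@dom_J_live _ dW l).
by apply: abs_summableZ; exact: (@dom_J_live _ dv l).
Qed.

Lemma value_shift W v t l : dom_J M eps Wt k W -> dom_J M eps Wt k v ->
  value (fun x => W x + t * v x) l = value W l + t * value v l.
Proof.
move=> dW dv; rewrite /value mul_shift; apply: has_xsumE; apply: has_xsumD.
  by apply: xsummableP; apply: abs_summable_summable; exact: (@dom_J_live _ dW l).
apply: has_xsumZ; apply: xsummableP; apply: abs_summable_summable.
exact: (@dom_J_live _ dv l).
Qed.

(** Along the line no series in [t] remains: an affine function minus a finite sum of mean
    posteriors times affine functions. *)
Lemma J_shift W v t : dom_J M eps Wt k W -> dom_J M eps Wt k v ->
  J M eps Wt k (fun x => W x + t * v x) =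
  (dJ_p M k W + t * dJ_p M k v) -
  \sum_l q (fun x => W x + t * v x) l * (value W l + t * value v l).
Proof.
move=> dW dv; have [_ kW _] := dW; have [_ kv _] := dv.
rewrite /J; congr (_ - _).
  rewrite mul_shift; apply: has_xsumE; apply: has_xsumD.
    exact: (xsummableP (abs_summable_summable kW)).
  exact: (has_xsumZ (xsummableP (abs_summable_summable kv))).
under eq_bigr do rewrite -(value_shift _ _ dW dv).
rewrite (_ : (fun x => _) = fun x => (W x + t * v x) *
  \sum_l live_payoff l x * q (fun x => W x + t * v x) l); last first.
  by apply/funext => x; rewrite exec_priceE.
apply: has_xsumE; apply: (has_xsum_mul_live _ _).2 => l.
exact: (@dom_J_live _ (dom_J_shift t dW dv) l).
Qed.

Lemma dJ_AD_live W v : dom_J M eps Wt k v ->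
  abs_summable (fun x => v x * exec_price M eps Wt W x) /\
  dJ_AD M eps Wt v W = \sum_l q W l * value v l.
Proof.
move=> dv; rewrite /dJ_AD (_ : (fun x => _) = fun x => v x *
  \sum_l live_payoff l x * q W l); last by apply/funext => x; rewrite exec_priceE.
have [s h] := has_xsum_mul_live (q W) (fun l => @dom_J_live _ dv l).
by split => //; exact: has_xsumE.
Qed.

Lemma dJ_K_live W v : dom_J M eps Wt k W ->
  abs_summable (fun x => W x * mean_price_impact M eps Wt v W x) /\
  dJ_K M eps Wt v W = \sum_l r v W l * value W l.
Proof.
move=> dW; rewrite /dJ_K (_ : (fun x => _) = fun x => W x *
  \sum_l live_payoff l x * r v W l); last first.
  by apply/funext => x; rewrite mean_price_impactE.
have [s h] := has_xsum_mul_live (r v W) (fun l => @dom_J_live _ dW l).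
by split => //; exact: has_xsumE.
Qed.

Lemma is_gateaux_J W v : dom_J M eps Wt k W -> dom_J M eps Wt k v ->
  is_gateaux (J M eps Wt k) W v
    (dJ_p M k v - (dJ_AD M eps Wt v W + dJ_K M eps Wt v W)).
Proof.
move=> dW dv; have [pW _ _] := dW; have [pv _ _] := dv.
rewrite /is_gateaux (dJ_AD_live _ dv).2 (dJ_K_live _ dW).2 -big_split/=.
rewrite (_ : (fun t => _) = (fun t => dJ_p M k W + t * dJ_p M k v) -
  (fun t => \sum_l q (fun x => W x + t * v x) l *
     (value W l + t * value v l))); last first.
  by apply/funext => t; exact: J_shift.
have affine (a b : R) : is_derive (0 : R) (1 : R) (fun t : R => a + t * b) b.
  have d1 := is_deriveD (is_derive_cst a (0 : R) (1 : R))
    (is_deriveM (is_derive_id (0 : R) (1 : R)) (is_derive_cst b (0 : R) (1 : R))).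
  apply: (is_derive_eq d1).
  by rewrite /GRing.scale/= mulr0 !add0r mulr1.
apply: is_deriveB => //; apply: is_derive_bigsum => l.
have dq := is_derive_mean_posterior l pW pv.
(* In the product rule, the derivative of the mean posterior yields [dJ_K] and that of the affine
   factor yields [dJ_AD]. *)
have dM := is_deriveM dq (affine (value W l) (value v l)).
apply: (is_derive_eq dM); rewrite /GRing.scale/= mul0r addr0.
rewrite (_ : (fun x => W x + 0 * v x) = W) 1?[_ * r v W l]mulrC//.
by apply/funext => x; rewrite mul0r addr0.
Qed.

(** One exceptional set serves all securities: the flows outside [likelihood_defined], whose
    preimage under [realized_flow] is null. *)
Lemma ae_is_gateaux_price W v : portfolio M W -> portfolio M v ->
  {ae flow_law eps W, forall w : order_flow R X, forall x : X,
     is_gateaux (price M Wt x) w v (price_impact M Wt v x w)}.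
Proof.
move=> sW sv; have mL := measurable_likelihood_defined M Wt.
exists (~` [set w | likelihood_defined M Wt w]); split.
- exact: measurableC.
- have [N [mN N0 sN]] := ae_likelihood_defined sW.
  have mpre : measurable (realized_flow eps W @^-1`
      (~` [set w | likelihood_defined M Wt w])).
    rewrite -[X in measurable X]setTI; apply: measurable_realized_flow => //.
    exact: measurableC.
  exact: (subset_measure0 mpre mN sN N0).
- by move=> w; apply: contra_not => dw x; exact: is_gateaux_price.
Qed.

Lemma first_order_condition W v : optimal M eps Wt k W -> dom_J M eps Wt k v ->
  dJ_p M k v = dJ_AD M eps Wt v W + dJ_K M eps Wt v W.
Proof.
move=> [dW maxW] dv; apply/eqP; rewrite -subr_eq0; apply/eqP.
pose g t := J M eps Wt k (fun x => W x + t * v x).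
(* [derive1_at_max] asks for differentiability on a whole interval; at [t] it comes from the Gateaux
   derivative based at [W + t v], reparametrised by the offset [s]. *)
have dg t : derivable g t 1.
  have /@ex_derive := is_gateaux_J (dom_J_shift t dW dv) dv.
  pose G s := J M eps Wt k (fun x => W x + t * v x + s * v x).
  have GE s : G s = g (s + t).
    by congr (J M eps Wt k _); apply/funext => x; rewrite mulrDl addrA addrAC.
  rewrite /derivable -/G => c.
  rewrite (_ : (fun h : R => _) =
    (fun h : R => h^-1 *: ((G \o shift 0) (h *: 1) - G 0))) //.
  by apply/funext => h /=; rewrite !GE addr0 add0r.
have g0 : g 0 = J M eps Wt k W.
  by congr (J M eps Wt k _); apply/funext => x; rewrite mul0r addr0.
have D0 : is_derive (0 : R) (1 : R) g 0.
  (* The whole line stays in [dom_J], so [g] is maximal at 0; the endpoints -1 and 1 only make 0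
     interior. *)
  apply: (@derive1_at_max _ g (-1) 1).
  - by rewrite (le_trans (lerN10 _)) ?ler01.
  - by move=> t _; exact: dg.
  - by rewrite in_itv/= ltrN10 ltr01.
  - by move=> t _; rewrite g0; apply: maxW; exact: dom_J_shift.
rewrite -(@derive_val _ _ _ _ _ _ _ (is_gateaux_J dW dv)).
exact: (@derive_val _ _ _ _ _ _ _ D0).
Qed.

End insider.

Theorem theorem5p1 (R : realType) (X : countType) (S : finType)
  (M : market R X S)
  (d : measure_display) (Omega : measurableType d) (P : probability Omega R)
  (eps : X -> {RV P >-> R}) (k : S) (Wt : X -> S -> R)
  (noise_gaussian : gaussian_noise M eps)
  (belief_square_summable : forall l : S, portfolio M (fun x => Wt x l)) :
  (forall W v : X -> R, dom_J M eps Wt k W -> dom_J M eps Wt k v ->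
     [/\ is_gateaux (J M eps Wt k) W v
           (dJ_p M k v - (dJ_AD M eps Wt v W + dJ_K M eps Wt v W)),
         abs_summable (fun x => v x * exec_price M eps Wt W x),
         abs_summable (fun x => W x * mean_price_impact M eps Wt v W x) &
         {ae flow_law eps W, forall w : order_flow R X, forall x : X,
            is_gateaux (price M Wt x) w v (price_impact M Wt v x w)}]) /\
  (forall W : X -> R, optimal M eps Wt k W ->
     forall v : X -> R, dom_J M eps Wt k v ->
       dJ_p M k v = dJ_AD M eps Wt v W + dJ_K M eps Wt v W).
Proof.
split=> [W v dW dv|W oW v dv].
  have [pW _ _] := dW; have [pv _ _] := dv; split.
  - exact: is_gateaux_J.
  - exact: (dJ_AD_live W dv).1.
  - exact: (dJ_K_live v dW).1.
  - exact: (ae_is_gateaux_price noise_gaussian (@belief_square_summable) pW pv).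
exact: (first_order_condition noise_gaussian (@belief_square_summable) oW dv).
Qed.
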